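(* There exists a constant $C>0$, not depending on $N$, such that the following holds for every integer $N\ge 2$. Let $x_1>x_2>\dots>x_N$ be the unique strictly decreasing, zero-mean ($x_1+\dots+x_N=0$) solution of the recursion $$x_{n+1}=x_n-\frac{1}{x_1+\cdots+x_n},\qquad 1\le n\le N-1,$$ and let $\mathbb{P}_N$ be its empirical distribution, $\mathbb{P}_N(A)=\#\{n: x_n\in A\}/N$ for Borel sets $A\subseteq\mathbb{R}$. Let $\gamma$ be the standard normal distribution on $\mathbb{R}$. Then $$\frac{1}{2N}\le d_{\mathrm K}(\mathbb{P}_N,\gamma)\le \frac{55}{N}$$ and $$\frac{\sqrt{\log (N/2)}}{2N}-\frac{C}{N}\le d_{\mathrm W}(\mathbb{P}_N,\gamma)\le \frac{16\sqrt{\log N}}{N}.$$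
   Context: It is known (McKeague and Levin) that for each $N\ge 2$ the recursion has exactly one real solution $(x_1,\dots,x_N)$ that is strictly decreasing and satisfies $x_1+\dots+x_N=0$; this solution also satisfies $x_1^2+\dots+x_N^2=N-1$ and $x_n=-x_{N+1-n}$ for $1\le n\le N$. The Kolmogorov distance is $d_{\mathrm K}(\mathbb{P}_N,\gamma)=\sup_{z\in\mathbb{R}}|\mathbb{P}_N((-\infty,z])-\gamma((-\infty,z])|$. The Wasserstein distance is $d_{\mathrm W}(\mathbb{P}_N,\gamma)=\sup_h\left|\int_{\mathbb{R}} h\,d\mathbb{P}_N-\int_{\mathbb{R}} h\,d\gamma\right|$, the supremum being over all $h:\mathbb{R}\to\mathbb{R}$ with $|h(x)-h(y)|\le |x-y|$ for all $x,y$. The symbol $\log$ denotes the natural logarithm. *)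

(* Defs.v *)
From HB Require Import structures.
From mathcomp Require Import all_boot all_order all_algebra.
From mathcomp Require Import all_classical all_reals all_analysis.

Set Implicit Arguments.
Unset Strict Implicit.
Unset Printing Implicit Defensive.

Import Order.TTheory GRing.Theory Num.Theory.
Import numFieldNormedType.Exports.

Local Open Scope classical_set_scope.
Local Open Scope ring_scope.

(* The index i : 'I_N stands for n = i + 1 in the one-based numbering
   x_1, ..., x_N. At a vanishing partial sum the total inverse 0^-1 = 0 would
   give x_{n+1} = x_n, which strictly_decreasing excludes. *)
Definition satisfies_recursion (R : realType) (N : nat) (x : 'I_N -> R) : Prop :=
  forall i j : 'I_N, j = i.+1 :> nat ->
    x j = x i - 1 / \sum_(k < N | (k <= i)%N) x k.

Definition strictly_decreasing (R : realType) (N : nat) (x : 'I_N -> R) : Prop :=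
  forall i j : 'I_N, (i < j)%N -> x j < x i.

Definition empirical (R : realType) (N : nat) (x : 'I_N -> R)
    (A : set (measurableTypeR R)) : \bar R :=
  (#|[set n : 'I_N | x n \in A]%SET|%:R / N%:R)%:E.

Section empirical_measure.
Local Open Scope ereal_scope.
Context (R : realType) (N : nat) (x : 'I_N -> R).

Let atom (k : nat) : measurableTypeR R := oapp x 0%R (insub k).

Let atoms (k : nat) : {measure set (measurableTypeR R) -> \bar R} :=
  \d_(atom k).


Let invN_ge0 : (0 <= N%:R^-1 :> R)%R.
Proof. by rewrite invr_ge0 ler0n. Qed.

Let empiricalE :
  empirical x = mscale (NngNum invN_ge0) (msum atoms N).
Proof.
apply/funext => A; rewrite /mscale /empirical /= /msum.
rewrite (eq_bigr (fun k : 'I_N => ((x k \in A)%:R : R)%:E)); last first.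
  by move=> k _; rewrite /atoms /= diracE /atom valK.
rewrite sumEFin -EFinM mulrC -natr_sum; congr (_ * _%:R)%:E.
by rewrite -sum1_card big_mkcond; apply: eq_bigr => k _; rewrite inE; case: ifP.
Qed.

Let empirical0 : empirical x set0 = 0.
Proof. by rewrite empiricalE measure0. Qed.

Let empirical_ge0 A : 0 <= empirical x A.
Proof. by rewrite empiricalE measure_ge0. Qed.

Let empirical_sigma_additive : semi_sigma_additive (empirical x).
Proof. by rewrite empiricalE; exact: measure_semi_sigma_additive. Qed.

HB.instance Definition _ := isMeasure.Build _ _ _ (empirical x)
  empirical0 empirical_ge0 empirical_sigma_additive.

End empirical_measure.

(* Suprema are taken in \bar R, so that no boundedness has to be known in
   advance (the real-valued sup of an unbounded set is a junk value). *)
Definition kolmogorov_dist (R : realType)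
    (mu nu : {measure set (measurableTypeR R) -> \bar R}) : \bar R :=
  ereal_sup [set `|mu `]-oo, z]%classic - nu `]-oo, z]%classic|%E | z in [set: R]].

Definition wasserstein_dist (R : realType)
    (mu nu : {measure set (measurableTypeR R) -> \bar R}) : \bar R :=
  ereal_sup [set `|\int[mu]_x (h x)%:E - \int[nu]_x (h x)%:E|%E
            | h in [set h : R -> R | forall x y, `|h x - h y| <= `|x - y|]].

(* Main.v *)
Require Import Defs.
From HB Require Import structures.
From mathcomp Require Import all_boot all_order all_algebra.
From mathcomp Require Import all_classical all_reals all_analysis.
From mathcomp Require Import measurable_realfun zify ring lra.

Set Implicit Arguments.
Unset Strict Implicit.
Unset Printing Implicit Defensive.

Import Order.TTheory GRing.Theory Num.Theory.
Import numFieldNormedType.Exports.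

Local Open Scope classical_set_scope.
Local Open Scope ring_scope.

(** Write [S_n = x_1 + ... + x_n], so that [x_n - x_(n+1) = 1 / S_n], and let
    [F] and [f] be the standard normal distribution function and density. The
    ratio [A = F / f] satisfies [A' = 1 + w A] with [w A] nondecreasing and at
    least [-1] (Mills). By the mean value theorem
    [S_n (A x_n - A x_(n+1))] lies between [1 + x_(n+1) A x_(n+1)] and
    [1 + x_n A x_n], and descending induction on [n] gives
    [N - n <= S_n A x_n] and [S_(n-1) A x_n <= N - n + 1]. The same bounds for
    the reflected solution [-x_(N+1-n)] concern [(1 - F) / f]; eliminating
    [S_n] and [S_(n-1)] yields [N - n <= N F(x_n) <= N - n + 1], which puts the
    [n]-th atom into the [n]-th quantile cell, whence the Kolmogorov distance
    is at most [1/N]; it is at least [1/(2N)] because of the jumps.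

    From [n x_n <= S_n <= n x_1] and harmonic sums,
    [2 sqrt (log (N/2)) <= x_1 - x_N <= 2 sqrt (2 (1 + log N))]. A
    1-Lipschitz function differs from a step function with steps at the atoms
    by little enough to give the upper Wasserstein bound
    [(3 (x_1 - x_N) + 2) / N]. For the lower one, the test function is the
    distance to the set of atoms on [[x_N, x_1]]: its normal integral is
    essentially the sum of [gap^2 f / 4], where [gap * f] is at least
    [(n - 1) / (n N)] on the positive side. *)

(** * Harmonic sums and the recursion *)

Section harmonic_bounds.
Context {R : realType}.

Lemma ln_succ_le (n : nat) : ln n.+2%:R <= ln n.+1%:R + n.+1%:R^-1 :> R.
Proof.
have n0 : 0 < n.+1%:R :> R by [].
have -> : n.+2%:R = n.+1%:R * (1 + n.+1%:R^-1) :> R.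
  by rewrite mulrDr divff ?gt_eqF// mulr1 -natr1.
rewrite lnM ?posrE ?addr_gt0 ?invr_gt0// lerD2l le_ln1Dx//.
by rewrite (lt_trans (ltrN10 _))// invr_gt0.
Qed.

Lemma ln_succ_ge (n : nat) : ln n.+1%:R + n.+2%:R^-1 <= ln n.+2%:R :> R.
Proof.
have n0 : 0 < n.+2%:R :> R by [].
have n2 : n.+2%:R^-1 < 1 :> R by rewrite invf_lt1// ltr1n.
have -> : n.+1%:R = n.+2%:R * (1 - n.+2%:R^-1) :> R.
  by rewrite mulrBr divff ?gt_eqF// mulr1 -[n.+2%:R]natr1 addrK.
rewrite lnM ?posrE ?subr_gt0// -addrA gerDl -lerBrDr sub0r le_ln1Dx//.
by rewrite ltrN2.
Qed.

Lemma ln_le_harmonic (n : nat) : ln n.+1%:R <= \sum_(i < n) i.+1%:R^-1 :> R.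
Proof.
elim: n => [|n IHn]; first by rewrite big_ord0 ln1.
by rewrite big_ord_recr/= (le_trans (ln_succ_le _))// lerD2r.
Qed.

Lemma harmonic_le_ln (n : nat) :
  \sum_(i < n) i.+1%:R^-1 <= 1 + ln n.+1%:R :> R.
Proof.
case: n => [|n]; first by rewrite big_ord0 ln1 addr0.
apply: (@le_trans _ _ (1 + ln n.+1%:R)); last first.
  by rewrite lerD2l ler_ln ?posrE// ler_nat.
elim: n => [|n IHn]; first by rewrite big_ord1 ln1 invr1 addr0.
by rewrite big_ord_recr/= (le_trans (lerD IHn (lexx _)))// -addrA lerD2l ln_succ_ge.
Qed.

Lemma sum_inv_sqr_le2 (n : nat) : \sum_(i < n) (i.+1%:R ^+ 2)^-1 <= 2 :> R.
Proof.
case: n => [|n]; first by rewrite big_ord0.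
(* The subtracted [n.+1%:R^-1] makes the induction telescope: 1/(a+1)^2 <= 1/a - 1/(a+1). *)
apply: (@le_trans _ _ (2 - n.+1%:R^-1)); last by rewrite gerDl oppr_le0 invr_ge0.
elim: n => [|n IHn]; first by rewrite big_ord1 expr1n invr1; lra.
rewrite big_ord_recr/= (le_trans (lerD IHn (lexx _)))// -addrA lerD2l.
rewrite -[n.+2%:R]natr1; have : 0 < n.+1%:R :> R by [].
move: (n.+1%:R : R) => a a0; have a1 : 0 < a + 1 by lra.
have -> : - a^-1 = - (a + 1)^-1 - (a * (a + 1))^-1 by field; rewrite !gt_eqF.
rewrite -addrA gerDl addrC subr_le0 lef_pV2 ?posrE ?exprn_gt0 ?mulr_gt0//.
by rewrite expr2 ler_pM2r//; lra.
Qed.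

(** Uses 2/3 = 10/15, exp(1/15) <= 15/14 and (15/14)^10 <= 2. *)
Lemma ln2_ge : 2 / 3 <= ln 2 :> R.
Proof.
rewrite -ler_expR lnK ?posrE//.
have e0 : expR (15^-1 : R) <= 15 / 14.
  have e0 := expR_gt0 (15^-1 : R).
  have := expR_ge1Dx (- 15^-1 : R).
  by rewrite expRN -(ler_pM2r e0) mulVf ?gt_eqF//; lra.
have -> : 2 / 3 = 10%:R * 15^-1 :> R by lra.
rewrite expRM_natl; apply: (le_trans (y := (15 / 14) ^+ 10)); last by lra.
by rewrite lerXn2r// nnegrE ?expR_ge0//; lra.
Qed.

End harmonic_bounds.

(** The sequences below are indexed from [0]: [X n] is [x_(n+1)], while
    [psum X n] is [x_1 + ... + x_n]. *)
Definition psum {R : realType} (X : nat -> R) (n : nat) : R := \sum_(i < n) X i.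

(** Sequences on all of [nat] avoid ordinal arithmetic; only values at indices below [N] are
    constrained. *)
Record mw_solution {R : realType} (N : nat) (X : nat -> R) : Prop := MWSolution {
  mw_decr : forall n, (n.+1 < N)%N -> X n.+1 < X n ;
  mw_sum0 : psum X N = 0 ;
  mw_rec : forall n, (n.+1 < N)%N -> X n.+1 = X n - (psum X n.+1)^-1 }.

(** The symmetry of the problem, which carries each estimate at the upper end over to the lower
    end. *)
Definition mw_rev {R : realType} (N : nat) (X : nat -> R) (i : nat) : R :=
  - X (N.-1 - i)%N.

(** * Partial sums, reflection and growth of solutions *)

Section mw_solution_theory.
Context {R : realType}.
Implicit Types (X : nat -> R) (N n : nat).

Lemma psumS X n : psum X n.+1 = psum X n + X n.
Proof. by rewrite /psum big_ord_recr. Qed.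

Lemma mw_gap N X : mw_solution N X ->
  forall n, (n.+1 < N)%N -> X n - X n.+1 = (psum X n.+1)^-1.
Proof. by move=> hX n nN; rewrite (mw_rec hX nN) opprB addrCA subrr addr0. Qed.

(** The gap is the reciprocal of the partial sum, so strict decrease makes both positive and
    excludes the default [0^-1 = 0]. *)
Lemma mw_psum_gt0 N X : mw_solution N X ->
  forall n, (n.+1 < N)%N -> 0 < psum X n.+1.
Proof.
by move=> hX n nN; rewrite -invr_gt0 -(mw_gap hX nN) subr_gt0 (mw_decr hX).
Qed.

Lemma mw_gapK N X : mw_solution N X ->
  forall n, (n.+1 < N)%N -> psum X n.+1 * (X n - X n.+1) = 1.
Proof.
by move=> hX n nN; rewrite (mw_gap hX nN) divff// gt_eqF// (mw_psum_gt0 hX).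
Qed.

Lemma mw_nonincr N X : mw_solution N X ->
  forall m n, (m <= n < N)%N -> X n <= X m.
Proof.
move=> hX m n /andP[]; elim: n => [|n IHn]; first by rewrite leqn0 => /eqP ->.
rewrite leq_eqVlt => /predU1P[->//|mn] nN.
by rewrite (le_trans (ltW (mw_decr hX nN)))// IHn// ltnW.
Qed.

Lemma mw_psum_le N X : mw_solution N X ->
  forall n, (n <= N)%N -> psum X n <= n%:R * X 0.
Proof.
move=> hX; elim=> [|n IHn] nN; first by rewrite /psum big_ord0 mul0r.
rewrite psumS -natr1 mulrDl mul1r lerD ?IHn 1?ltnW//.
by rewrite (mw_nonincr hX).
Qed.

Lemma mw_psum_ge N X : mw_solution N X ->
  forall n, (n < N)%N -> n.+1%:R * X n <= psum X n.+1.
Proof.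
move=> hX n nN; have -> : n.+1%:R * X n = \sum_(i < n.+1) X n.
  by rewrite sumr_const card_ord mulr_natl.
by apply: ler_sum => i _; rewrite (mw_nonincr hX)// -ltnS ltn_ord.
Qed.

(** As the total is zero, negating the last [n] values gives the sum of the others. *)
Lemma psum_rev N X n : psum X N = 0 -> (n <= N)%N ->
  psum (mw_rev N X) n = psum X (N - n)%N.
Proof.
move=> s0; elim: n => [|n IHn] nN.
  by rewrite subn0 s0 /psum big_ord0.
rewrite psumS IHn 1?ltnW// /mw_rev.
have -> : (N - n = (N.-1 - n).+1)%N by lia.
by rewrite psumS addrK; congr psum; lia.
Qed.

(** By [psum_rev] the partial sums, hence the gaps, are those of [X] in reverse order. *)
Lemma mw_rev_solution N X : mw_solution N X -> mw_solution N (mw_rev N X).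
Proof.
move=> hX; have nS n : (n.+1 < N)%N -> (N.-1 - n = (N.-1 - n.+1).+1)%N by lia.
split=> [n nN||n nN].
- by rewrite /mw_rev (nS n nN) ltrN2 (mw_decr hX)//; lia.
- by rewrite psum_rev ?(mw_sum0 hX)// subnn /psum big_ord0.
- have nN' : ((N.-1 - n.+1).+1 < N)%N by lia.
  rewrite psum_rev ?(mw_sum0 hX)// 1?ltnW// /mw_rev (nS n nN) (mw_rec hX nN').
  have -> : (N - n.+1 = (N.-1 - n.+1).+1)%N by lia.
  by rewrite opprB addrAC subrr add0r.
Qed.

Lemma mw_first_gt0 N X : (1 < N)%N -> mw_solution N X -> 0 < X 0.
Proof. by move=> N1 hX; have := mw_psum_gt0 hX N1; rewrite /psum big_ord1. Qed.

Lemma mw_last_lt0 N X : (1 < N)%N -> mw_solution N X -> X N.-1 < 0.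
Proof.
move=> N1 /mw_rev_solution/(mw_first_gt0 N1).
by rewrite /mw_rev subn0 oppr_gt0.
Qed.

(* [A] stands for the ratio of the normal distribution function to its density,
   whose derivative is the nondecreasing function [1 + w * A w]; the two
   inequalities are discrete forms of Stein's identity for [A]. *)
Lemma mw_stein_ratio (A : R -> R) N X : mw_solution N X ->
  (forall v u : R, v < u -> (u - v) * (1 + v * A v) <= A u - A v
                        <= (u - v) * (1 + u * A u)) ->
  (forall w, -1 <= w * A w) ->
  forall n, (n < N)%N -> (N - n.+1)%:R <= psum X n.+1 * A (X n) /\
                         psum X n * A (X n) <= (N - n)%:R.
Proof.
(* Descending induction on [n], run on the number [k] of later indices. *)
move=> hX dA A1 n nN; have [k kN] : {k | k = N - n.+1}%N by exists (N - n.+1)%N.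
elim: k n kN nN => [|k IHk] n kN nN.
  (* At the last index the full sum vanishes and [psum X n] is [- X n], so the second bound is the
     hypothesis [A1]. *)
  have nE : n.+1 = N by lia.
  have /eqP := mw_sum0 hX; rewrite -{1}nE psumS addr_eq0 => /eqP ->.
  rewrite nE subnn addNr mul0r; split=> //.
  have -> : (N - n = 1)%N by lia.
  by rewrite mulNr lerNl A1.
have nN' : (n.+1 < N)%N by lia.
have [ih1 ih2] := IHk n.+1 ltac:(lia) nN'.
have S0 := mw_psum_gt0 hX nN'.
have /andP[] := dA _ _ (mw_decr hX nN').
rewrite -(ler_pM2l S0) mulrA (mw_gapK hX)// mul1r mulrBr => lo.
rewrite -(ler_pM2l S0) mulrA (mw_gapK hX)// mul1r mulrBr => hi.
move: ih1 ih2 lo hi; rewrite (psumS _ n.+1).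
have -> : (N - n = (N - n.+1).+1)%N by lia.
have -> : (N - n.+1 = (N - n.+2).+1)%N by lia.
move: (N - n.+2)%N => j.
(* In [lo] the term [X n.+1 * A (X n.+1)] extends the partial sum to [n.+2]; in [hi] the term
   [X n * A (X n)] shortens it to [n]. *)
rewrite -[j.+2%:R]natr1 -[j.+1%:R]natr1 (psumS _ n) => ih1 ih2 lo hi; split; lra.
Qed.

(** Since [n.+1%:R * X n <= psum X n.+1], the product of [X n] and its gap is at most 1/(n+1), and
    a^2 - b^2 <= 2a(a - b). Truncating the square at 0 makes it vanish at the last value, which
    leaves a harmonic sum. *)
Lemma mw_first_sqr_le N X : (1 < N)%N -> mw_solution N X ->
  X 0 ^+ 2 <= 2 * (1 + ln N%:R).
Proof.
move=> N1 hX; pose p (t : R) := Num.max t 0 ^+ 2.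
have step n : (n.+1 < N)%N -> p (X n) - p (X n.+1) <= 2 * n.+1%:R^-1.
  move=> nN; have g0 := mw_decr hX nN.
  have n0 : 0 < n.+1%:R :> R by [].
  have := mw_psum_ge hX (ltnW nN).
  rewrite -(ler_pM2r (_ : 0 < X n - X n.+1)) ?subr_gt0// (mw_gapK hX)// -mulrA.
  rewrite -ler_pdivlMl// mulr1 => le.
  have i0 : 0 < n.+1%:R^-1 :> R by rewrite invr_gt0.
  move: g0 le i0; rewrite /p; move: (X n) (X n.+1) (n.+1%:R^-1) => a b i g0 le i0.
  case: (leP a 0) => xn; case: (leP b 0) => xn1.
  - by lra.
  - by lra.
  - have : a * b <= 0 by rewrite pmulr_rle0.
    lra.
  - have := sqr_ge0 (a - b); lra.
have : p (X 0) - p (X N.-1) <= 2 * \sum_(i < N.-1) i.+1%:R^-1.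
  have : (N.-1 < N)%N by lia.
  elim: (N.-1) => [|m IHm] mN; first by rewrite big_ord0 subrr mulr0.
  rewrite big_ord_recr/= mulrDr.
  by have := lerD (IHm (ltnW mN)) (step _ mN); rewrite addrA subrK.
rewrite /p (max_idPr (ltW (mw_last_lt0 N1 hX))).
rewrite (max_idPl (ltW (mw_first_gt0 N1 hX))) expr0n/= subr0 => /le_trans; apply.
rewrite ler_pM2l// (le_trans (harmonic_le_ln _))// prednK//; exact: ltnW.
Qed.

(** Each partial sum of k terms is at most k times [X 0], so [X 0] times the k-th gap is at least
    1/k. *)
Lemma mw_first_gap_ge N X n : mw_solution N X -> (n < N)%N ->
  ln n.+1%:R <= X 0 * (X 0 - X n).
Proof.
move=> hX nN; apply: (le_trans (ln_le_harmonic _)).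
elim: n nN => [|n IHn] nN; first by rewrite big_ord0 subrr mulr0.
rewrite big_ord_recr/=; apply: (le_trans (lerD (IHn (ltnW nN)) (lexx _))).
have g0 := mw_decr hX nN.
have := mw_psum_le hX (ltnW nN).
rewrite -(ler_pM2r (_ : 0 < X n - X n.+1)) ?subr_gt0// (mw_gapK hX)// -mulrA.
rewrite -ler_pdivrMl// mulr1; move: (n.+1%:R^-1) => i; lra.
Qed.

(** [mw_first_gap_ge] is applied from both ends up to a middle value [m], with at least N/2 points
    on each side counting [m]; then [m] is eliminated. *)
Lemma mw_range_ge N X : (1 < N)%N -> mw_solution N X ->
  2 * Num.sqrt (ln (N%:R / 2)) <= X 0 - X N.-1.
Proof.
move=> N1 hX; have a0 := mw_first_gt0 N1 hX; have b0 := mw_last_lt0 N1 hX.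
have m1 : ((uphalf N).-1 < N)%N by rewrite uphalfE; lia.
have := mw_first_gap_ge hX m1.
have m2 : (N.-1 - (uphalf N).-1 < N)%N by lia.
have := mw_first_gap_ge (mw_rev_solution hX) m2.
rewrite /mw_rev subn0 opprK.
have -> : (N.-1 - (N.-1 - (uphalf N).-1) = (uphalf N).-1)%N by rewrite uphalfE; lia.
set m := X (uphalf N).-1; set a := X 0; set b := X N.-1.
set L := ln (N%:R / 2).
have N2 : 1 <= N%:R / 2 :> R by rewrite ler_pdivlMr// mul1r ler_nat.
have L0 : 0 <= L by exact: ln_ge0.
have lnL k : (N <= k.+1.*2)%N -> L <= ln k.+1%:R.
  move=> Nk; rewrite ler_ln ?posrE//; last by rewrite (lt_le_trans _ N2).
  by rewrite ler_pdivrMr// -natrM ler_nat muln2.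
move=> h1 h2.
have {}h1 : L <= - b * (- b + m).
  by apply: le_trans h1; apply: lnL; rewrite uphalfE; lia.
have {}h2 : L <= a * (a - m).
  by apply: le_trans h2; apply: lnL; rewrite uphalfE; lia.
have D0 : 0 <= a - b by rewrite /a /b; lra.
rewrite -(@ler_pXn2r _ 2)// ?nnegrE ?mulr_ge0 ?sqrtr_ge0//.
rewrite exprMn sqr_sqrtr//.
(* [L (1/a + 1/(-b)) <= a - b] and [1/a + 1/(-b) >= 4/(a - b)] *)
have h3 : L * (a - b) <= a * (- b) * (a - b).
  have : L * (- b) <= a * (a - m) * (- b) by rewrite ler_pM2r// oppr_gt0.
  have : L * a <= - b * (- b + m) * a by rewrite ler_pM2r.
  nra.
have {}h3 : L <= a * (- b) by move: h3; rewrite ler_pM2r// subr_gt0 /a /b; lra.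
have := sqr_ge0 (a + b); nra.
Qed.

(* Every gap beyond level [1] is at most [1/(n+1)], so the deficit
   [gap/(n+1)] is summable. *)
Lemma mw_upper_gaps_ge N X : (1 < N)%N -> mw_solution N X ->
  X 0 - 3 <=
  \sum_(i < N.-1 | 0 <= X i.+1) (X i - X i.+1) * (i%:R / i.+1%:R).
Proof.
move=> N1 hX; pose M (t : R) := Num.max t 1.
have step n : (n.+1 < N)%N -> M (X n) - M (X n.+1) - (n.+1%:R ^+ 2)^-1 <=
    if 0 <= X n.+1 then (X n - X n.+1) * (n%:R / n.+1%:R) else 0.
  move=> nN; have g0 := mw_decr hX nN.
  have n0 : 0 < n.+1%:R :> R by [].
  have i0 : 0 < n.+1%:R^-1 :> R by rewrite invr_gt0.
  have i1 : n.+1%:R^-1 <= 1 :> R by rewrite invf_le1// ler1n.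
  have := mw_psum_ge hX (ltnW nN).
  rewrite -(ler_pM2r (_ : 0 < X n - X n.+1)) ?subr_gt0// (mw_gapK hX)// -mulrA.
  rewrite -ler_pdivlMl// mulr1 => le.
  have -> : n%:R / n.+1%:R = 1 - n.+1%:R^-1 :> R.
    by rewrite -[n%:R](addrK 1) natr1 mulrBl divff ?gt_eqF// mul1r.
  rewrite -exprVn /M; move: i0 i1 le; set i := n.+1%:R^-1 => i0 i1 le.
  (* If [X n <= 1], both truncations equal 1. Otherwise the gap is at most [i <= 1], so [X n.+1] is
     nonnegative and the gap is counted. *)
  case: (leP (X n) 1) => xn.
    rewrite (max_idPr (le_trans (ltW g0) xn)) subrr sub0r.
    case: ifP => _; nra.
  have gi : X n - X n.+1 <= i by nra.
  have x1 : 0 <= X n.+1 by lra.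
  rewrite x1.
  have : X n.+1 <= Num.max (X n.+1) 1 by rewrite le_max lexx.
  nra.
have : M (X 0) - M (X N.-1) - \sum_(i < N.-1) (i.+1%:R ^+ 2)^-1 <=
    \sum_(i < N.-1 | 0 <= X i.+1) (X i - X i.+1) * (i%:R / i.+1%:R).
  rewrite [leRHS]big_mkcond/=; have : (N.-1 < N)%N by lia.
  elim: (N.-1) => [|m IHm] mN; first by rewrite !big_ord0 !subrr.
  rewrite !big_ord_recr/=.
  have := lerD (IHm (ltnW mN)) (step _ mN); apply: le_trans.
  move: ((m.+1%:R ^+ 2)^-1) => i; lra.
have l1 : X N.-1 <= 1 by rewrite (le_trans (ltW (mw_last_lt0 N1 hX))).
apply: le_trans; rewrite /M (max_idPr l1).
(* The lost constant 3 is the level 1 plus the bound 2 on the inverse squares. *)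
have := sum_inv_sqr_le2 (R := R) N.-1.
have : X 0 <= Num.max (X 0) 1 by rewrite le_max lexx.
lra.
Qed.

End mw_solution_theory.

(** * The normal distribution function *)

Section calculus.
Context {R : realType}.
Implicit Types f df : R -> R.

Lemma is_derive_continuous f df : (forall x : R, is_derive x 1 f (df x)) ->
  continuous f.
Proof.
move=> dF x; apply: differentiable_continuous.
by apply/derivable1_diffP; case: (dF x).
Qed.

Lemma MVT_everywhere f df (a b : R) : a < b ->
  (forall x : R, is_derive x 1 f (df x)) ->
  exists2 c, a < c < b & f b - f a = df c * (b - a).
Proof.
move=> ab dF.
have cf : {within `[a, b], continuous f}.
  by apply: continuous_subspaceT; exact: is_derive_continuous dF.
have [c cab E] := MVT ab (fun x _ => dF x) cf.
by exists c => //; rewrite in_itv in cab.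
Qed.

Lemma is_derive_ge0_nondecreasing f df (b : R) :
  (forall x : R, is_derive x 1 f (df x)) -> (forall x, x <= b -> 0 <= df x) ->
  forall x y, x <= y -> y <= b -> f x <= f y.
Proof.
move=> dF df0 x y; rewrite le_eqVlt => /predU1P[->//|xy] yb.
have [c /andP[_ cy] E] := MVT_everywhere xy dF.
by rewrite -subr_ge0 E mulr_ge0 ?subr_ge0 ?(ltW xy)// df0// (le_trans (ltW cy)).
Qed.

(** A function that rises from the limit 0 is nonnegative; the tail inequalities below are all
    proved this way. *)
Lemma is_derive_ge0_cvgNy_ge0 f df (b : R) :
  (forall x : R, is_derive x 1 f (df x)) -> (forall x, x <= b -> 0 <= df x) ->
  f x @[x --> -oo] --> 0 -> forall x, x <= b -> 0 <= f x.
Proof.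
move=> dF df0 f0 x xb; apply: (cvgr_to_le f0).
near=> y; apply: (is_derive_ge0_nondecreasing dF df0) => //.
Unshelve. all: by end_near. Qed.

(** After reflection, one term of the exponential series gives x^k exp(-x) <= (k+1)!/x for x > 0. *)
Lemma cvgNy_expX (k : nat) : x ^+ k * expR x @[x --> -oo] --> (0 : R).
Proof.
apply/cvgNy_compNP; apply: norm_cvg0.
apply: (@squeeze_cvgr _ _ _ _ (cst 0) (fun x => (k.+1)`!%:R * x^-1)).
- near=> x; have x0 : 0 < x by near: x; apply: nbhs_pinfty_gt.
  rewrite normr_ge0/= normrM (ger0_norm (expR_ge0 _)) normrX normrN gtr0_norm//.
  have := expR_ge1Dxn k (ltW x0).
  rewrite expRN ler_pdivrMr ?expR_gt0// => h.
  have -> : x ^+ k = k.+1`!%:R / x * (x ^+ k.+1 / k.+1`!%:R).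
    have : k.+1`!%:R != 0 :> R by rewrite pnatr_eq0 gtn_eqF// fact_gt0.
    by move: (k.+1`!%:R : R) => c c0; rewrite exprS; field; rewrite c0 gt_eqF.
  rewrite ler_pM2l ?divr_gt0 ?ltr0n ?fact_gt0//.
  by apply: le_trans h; rewrite lerDr.
- exact: cvg_cst.
- rewrite -(mulr0 (k.+1`!%:R : R)); apply: cvgMr.
  apply/gtr0_cvgV0; last exact: cvg_id.
  by apply: nbhs_pinfty_gt.
Unshelve. all: by end_near. Qed.

End calculus.

(** * Density, distribution function and Mills inequalities *)

Section standard_normal.
Context {R : realType}.
Local Notation gauss := (normal_prob (0 : R) 1).
Local Notation mu := (@lebesgue_measure R).

Definition gpdf : R -> R := normal_pdf 0 1.

Definition gcdf (x : R) : R := fine (gauss `]-oo, x]).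

Lemma gpdfE x : gpdf x = normal_peak 1 * expR (- x ^+ 2 / 2).
Proof. by rewrite /gpdf normal_pdfE ?oner_neq0// /normal_fun subr0 expr1n. Qed.

Lemma gpdf_gt0 x : 0 < gpdf x.
Proof. by rewrite gpdfE mulr_gt0 ?expR_gt0// normal_peak_gt0 ?oner_neq0. Qed.

Lemma gpdfN x : gpdf (- x) = gpdf x.
Proof. by rewrite !gpdfE sqrrN. Qed.

Lemma continuous_gpdf : continuous gpdf.
Proof. by apply: continuous_normal_pdf; rewrite oner_neq0. Qed.

Lemma measurable_gpdf : measurable_fun [set: R] gpdf.
Proof. exact: measurable_normal_pdf. Qed.

Lemma is_derive_gpdf (x : R) : is_derive x 1 gpdf (- x * gpdf x).
Proof.
have -> : gpdf = (normal_peak 1 *: (expR \o (fun y : R => - y ^+ 2 / 2))).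
  by apply/funext => y; rewrite gpdfE.
apply: is_derive_eq => /=.
by rewrite /GRing.scale/= -[_ *: _]/(_ * _); field.
Qed.

Lemma gcdfE x : (gcdf x)%:E = gauss `]-oo, x].
Proof. by rewrite /gcdf fineK// fin_num_measure. Qed.

Lemma gcdf_ge0 x : 0 <= gcdf x.
Proof. by rewrite fine_ge0. Qed.

Lemma gcdf_le1 x : gcdf x <= 1.
Proof. by rewrite -lee_fin gcdfE probability_le1. Qed.

Lemma is_derive_gcdf (x : R) : is_derive x 1 gcdf (gpdf x).
Proof.
(* An end point beyond [x] makes [x] interior for the fundamental theorem of calculus. *)
have x1 : x < x + 1 by rewrite ltrDl.
have ip : mu.-integrable `]-oo, (x + 1)%R] (EFin \o gpdf).
  by apply: (integrableS _ _ (subsetT _)) => //; exact: integrable_normal_pdf.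
have [d1 d2] := continuous_FTC1 x1 ip (ltNyr _) (@continuous_gpdf x).
have -> : gcdf = fun y => (\int[mu]_(t in [set` `]-oo, y]%R]) gpdf t)%R by [].
by split; [exact: d1|rewrite -derive1E; exact: d2].
Qed.

(** The identity as a random variable: its distribution function under [gauss] is [gcdf], which
    supplies the limits at both infinities. *)
Let idTR : measurableTypeR R -> R := idfun.

#[local] HB.instance Definition _ :=
  @isMeasurableFun.Build _ _ _ _ idTR (@measurable_id _ _ setT).

Lemma cvg_gcdfNy0 : gcdf x @[x --> -oo] --> (0 : R).
Proof. exact/fine_cvg/(cvg_cdfNy0 (idTR : {RV gauss >-> R})). Qed.

Lemma cvg_gcdfy1 : gcdf x @[x --> +oo] --> (1 : R).
Proof. exact/fine_cvg/(cvg_cdfy1 (idTR : {RV gauss >-> R})). Qed.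

Lemma gauss_itvoy x : gauss `]x, +oo[ = (1 - gcdf x)%:E.
Proof. by rewrite -setCitvl probability_setC// EFinB gcdfE. Qed.

Lemma gauss_itvcy x : gauss `[x, +oo[ = (1 - gcdf x)%:E.
Proof.
rewrite -gauss_itvoy /normal_prob integral_itv_obnd_cbnd//.
by apply/measurable_EFinP/measurable_funTS; exact: measurable_normal_pdf.
Qed.

Lemma gcdfN x : gcdf (- x) = 1 - gcdf x.
Proof.
apply: EFin_inj; rewrite gcdfE -gauss_itvcy /normal_prob.
rewrite (@ge0_integration_by_substitutionNy _ gpdf x).
- by apply: eq_integral => y _ /=; rewrite gpdfN.
- by apply: continuous_subspaceT; exact: continuous_gpdf.
- by move=> y _; rewrite normal_pdf_ge0.
Qed.

(** From (x + 1)^2 >= 0; this crude domination suffices for decay at -oo. *)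
Lemma gpdf_le_expR : exists2 K : R, 0 < K & forall x, gpdf x <= K * expR x.
Proof.
exists (normal_peak 1 * expR 2^-1).
  by rewrite mulr_gt0 ?expR_gt0// normal_peak_gt0 ?oner_neq0.
move=> x; rewrite gpdfE -mulrA -expRD ler_pM2l ?normal_peak_gt0 ?oner_neq0//.
rewrite ler_expR; have := sqr_ge0 (x + 1); lra.
Qed.

Lemma gcdf_le_expR : exists2 K : R, 0 < K & forall x, gcdf x <= K * expR x.
Proof.
have [K K0 hK] := gpdf_le_expR; exists K => // x; rewrite -subr_ge0.
apply: (@is_derive_ge0_cvgNy_ge0 _ ((K *: expR : R -> R) - gcdf)
  (fun y => K * expR y - gpdf y) x) => //.
- by move=> y; have ? := is_derive_gcdf y; exact: is_derive_eq.
- by move=> y _; rewrite subr_ge0.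
- rewrite -(subr0 (0 : R)); apply: cvgB; last exact: cvg_gcdfNy0.
  rewrite -(mulr0 K); apply: cvgMr.
  by have := cvgNy_expX (R := R) 0; under eq_fun do rewrite expr0 mul1r.
Qed.

Lemma cvgNy_dominated (f : R -> R) (K : R) (k : nat) :
  (forall x, 0 <= f x <= K * expR x) -> x ^+ k * f x @[x --> -oo] --> (0 : R).
Proof.
move=> fK; apply: norm_cvg0.
apply: (@squeeze_cvgr _ _ _ _ (cst 0) (fun x => K * `|x ^+ k * expR x|)).
- near=> x; rewrite normr_ge0/= !normrM mulrCA ler_wpM2l//.
  have /andP[f0 fx] := fK x.
  by rewrite ger0_norm// (ger0_norm (expR_ge0 _)).
- exact: cvg_cst.
- rewrite -(mulr0 K); apply: cvgMr; rewrite -(normr0 R).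
  have := cvg_norm (@cvgNy_expX R k); exact.
Unshelve. all: by end_near. Qed.

Lemma cvgNy_Xgpdf (k : nat) : x ^+ k * gpdf x @[x --> -oo] --> (0 : R).
Proof.
have [K _ hK] := gpdf_le_expR.
by apply: (@cvgNy_dominated _ K) => x; rewrite hK ltW ?gpdf_gt0.
Qed.

Lemma cvgNy_Xgcdf (k : nat) : x ^+ k * gcdf x @[x --> -oo] --> (0 : R).
Proof.
have [K _ hK] := gcdf_le_expR.
by apply: (@cvgNy_dominated _ K) => x; rewrite hK gcdf_ge0.
Qed.

(** Because f' = -x f, the derivative of this expression is [gcdf]. *)
Lemma mills_first x : 0 <= x * gcdf x + gpdf x.
Proof.
apply: (@is_derive_ge0_cvgNy_ge0 _ (fun y => y * gcdf y + gpdf y) gcdf x) => //.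
- move=> y; have ? := is_derive_gcdf y; have ? := is_derive_gpdf y.
  by apply: is_derive_eq; rewrite /GRing.scale/=; ring.
- by move=> y _; exact: gcdf_ge0.
- rewrite -(addr0 (0 : R)); apply: cvgD.
    exact: (cvgNy_Xgcdf 1).
  by have := cvgNy_Xgpdf 0; under eq_fun do rewrite expr0 mul1r.
Qed.

(** The derivative is twice the expression in [mills_first]. *)
Lemma mills_second x : 0 <= (1 + x ^+ 2) * gcdf x + x * gpdf x.
Proof.
apply: (@is_derive_ge0_cvgNy_ge0 _
  (fun y => (1 + y ^+ 2) * gcdf y + y * gpdf y)
  (fun y => 2 * (y * gcdf y + gpdf y)) x) => //.
- move=> y; have ? := is_derive_gcdf y; have ? := is_derive_gpdf y.
  by apply: is_derive_eq; rewrite /GRing.scale/=; ring.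
- by move=> y _; rewrite mulr_ge0// mills_first.
- rewrite -(addr0 (0 : R)); apply: cvgD; last exact: (cvgNy_Xgpdf 1).
  under eq_fun do rewrite mulrDl mul1r.
  rewrite -(addr0 (0 : R)); apply: cvgD; first exact: cvg_gcdfNy0.
  exact: (cvgNy_Xgcdf 2).
Qed.

(** By symmetry, the classical Mills ratio (upper tail over density) at [- x]. *)
Definition mills_ratio (x : R) : R := gcdf x / gpdf x.

Lemma is_derive_mills_ratio (x : R) :
  is_derive x 1 mills_ratio (1 + x * mills_ratio x).
Proof.
have p0 := gt_eqF (gpdf_gt0 x).
have ? := is_derive_gcdf x; have ? := is_derive_gpdf x.
have ? := is_deriveV (negbT p0) (is_derive_gpdf x).
apply: is_derive_eq; rewrite /GRing.scale/= /mills_ratio.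
by field; rewrite p0.
Qed.

Lemma mills_ratio_ge x : -1 <= x * mills_ratio x.
Proof.
rewrite mulrA ler_pdivlMr ?gpdf_gt0// mulN1r.
have := mills_first x; lra.
Qed.

(** The derivative is the expression in [mills_second] divided by the density; in other words,
    [mills_ratio] is convex. *)
Lemma mills_ratio_derive_nondecreasing x y : x <= y ->
  x * mills_ratio x <= y * mills_ratio y.
Proof.
move=> xy.
apply: (@is_derive_ge0_nondecreasing _ (fun y => y * mills_ratio y)
  (fun y => ((1 + y ^+ 2) * gcdf y + y * gpdf y) / gpdf y) y) => //.
- move=> z; have ? := is_derive_mills_ratio z.
  have p0 := gt_eqF (gpdf_gt0 z).
  apply: is_derive_eq; rewrite /GRing.scale/= /mills_ratio.
  by field; rewrite p0.
- by move=> z _; rewrite divr_ge0 ?mills_second// ltW ?gpdf_gt0.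
Qed.

Lemma mills_ratio_increment v u : v < u ->
  (u - v) * (1 + v * mills_ratio v) <= mills_ratio u - mills_ratio v
  <= (u - v) * (1 + u * mills_ratio u).
Proof.
move=> vu; have [c /andP[vc cu] ->] := MVT_everywhere vu is_derive_mills_ratio.
rewrite ![(u - v) * _]mulrC !ler_pM2r ?subr_gt0// !lerD2l.
by rewrite !mills_ratio_derive_nondecreasing// ltW.
Qed.

(** The left side is the mean overshoot below [x]; bounded by the tail mass, it is at most 1/N at
    the extreme atoms. *)
Lemma gauss_tail_le x : x <= 0 -> x * gcdf x + gpdf x <= gcdf x.
Proof.
move=> x0; have [Pp|pP] := leP (gpdf x) (gcdf x).
  by have := gcdf_ge0 x; nra.
(* below [x] the ratio stays below [1], so the difference of the two sides is
   nondecreasing, and it vanishes at [-oo] *)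
rewrite -subr_ge0.
apply: (@is_derive_ge0_cvgNy_ge0 _
  (fun y => gcdf y - (y * gcdf y + gpdf y)) (fun y => gpdf y - gcdf y) x) => //.
- move=> y; have ? := is_derive_gcdf y; have ? := is_derive_gpdf y.
  by apply: is_derive_eq; rewrite /GRing.scale/=; ring.
- move=> y yx; rewrite subr_ge0 -[leRHS]mul1r -ler_pdivrMr ?gpdf_gt0//.
  apply: (@le_trans _ _ (mills_ratio x)).
    apply: (is_derive_ge0_nondecreasing is_derive_mills_ratio _ yx (lexx _)).
    by move=> z _; have := mills_ratio_ge z; lra.
  by rewrite ler_pdivrMr ?gpdf_gt0// mul1r ltW.
- rewrite -(subr0 (0 : R)); apply: cvgB; first exact: cvg_gcdfNy0.
  rewrite -(addr0 (0 : R)); apply: cvgD; first exact: (cvgNy_Xgcdf 1).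
  by have := cvgNy_Xgpdf 0; under eq_fun do rewrite expr0 mul1r.
Qed.

End standard_normal.

(** * Quantile cells and Gaussian integrals *)

Section quantiles.
Context {R : realType}.
Implicit Types (X : nat -> R) (N n : nat).

(** The first two bounds are [mw_stein_ratio] for [X], the last two are the same lemma for
    [mw_rev N X] at the reflected index. *)
Lemma mw_psum_mills N X n : mw_solution N X -> (n < N)%N ->
  [/\ (N - n.+1)%:R * gpdf (X n) <= psum X n.+1 * gcdf (X n),
      psum X n * gcdf (X n) <= (N - n)%:R * gpdf (X n),
      n%:R * gpdf (X n) <= psum X n * (1 - gcdf (X n)) &
      psum X n.+1 * (1 - gcdf (X n)) <= n.+1%:R * gpdf (X n)].
Proof.
move=> hX nN; have p0 := gpdf_gt0 (X n).
have [] := mw_stein_ratio hX mills_ratio_increment mills_ratio_ge nN.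
have hY := mw_rev_solution hX.
have nN' : (N.-1 - n < N)%N by lia.
have [] := mw_stein_ratio hY mills_ratio_increment mills_ratio_ge nN'.
rewrite !psum_rev ?(mw_sum0 hX)//; last by lia.
have -> : mw_rev N X (N.-1 - n) = - X n by rewrite /mw_rev; congr (- X _); lia.
have -> : (N - (N.-1 - n).+1 = n)%N by lia.
have -> : (N - (N.-1 - n) = n.+1)%N by lia.
rewrite /mills_ratio gcdfN gpdfN !mulrA.
by rewrite !ler_pdivlMr// !ler_pdivrMr.
Qed.

Lemma mw_quantile N X n : mw_solution N X -> (n < N)%N ->
  (N - n.+1)%:R / N%:R <= gcdf (X n) <= (N - n)%:R / N%:R.
Proof.
move=> hX nN; have p0 := gpdf_gt0 (X n).
have [a1 a2 b1 b2] := mw_psum_mills hX nN.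
have P0 := gcdf_ge0 (X n); have P1 := gcdf_le1 (X n).
have N0 : 0 < N%:R :> R by rewrite ltr0n (leq_ltn_trans _ nN).
rewrite ler_pdivrMr// ler_pdivlMr//; apply/andP; split.
- have NE : N%:R = (N - n.+1)%:R + n.+1%:R :> R by rewrite -natrD subnK.
  (* Multiply [a1] by 1 - F and [b2] by F: the product S F (1 - F) is common to both. The other half
     treats [b1] and [a2] likewise. *)
  have : (N - n.+1)%:R * (1 - gcdf (X n)) <= n.+1%:R * gcdf (X n).
    rewrite -(ler_pM2r p0) mulrAC.
    apply: (le_trans (y := psum X n.+1 * gcdf (X n) * (1 - gcdf (X n)))).
      by rewrite ler_wpM2r ?subr_ge0.
    by rewrite mulrAC [leRHS]mulrAC ler_wpM2r.
  by rewrite NE; lra.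
- have NE : N%:R = (N - n)%:R + n%:R :> R by rewrite -natrD subnK// ltnW.
  have : n%:R * gcdf (X n) <= (N - n)%:R * (1 - gcdf (X n)).
    rewrite -(ler_pM2r p0) mulrAC.
    apply: (le_trans (y := psum X n * (1 - gcdf (X n)) * gcdf (X n))).
      by rewrite ler_wpM2r.
    by rewrite mulrAC [leRHS]mulrAC ler_wpM2r ?subr_ge0.
  by rewrite NE; lra.
Qed.

(** The gap is 1/S, and S (1 - F) <= (n+1) f by [mw_psum_mills], while 1 - F >= n/N by
    [mw_quantile]. *)
Lemma mw_gap_density N X n : mw_solution N X -> (n.+1 < N)%N ->
  n%:R / n.+1%:R / N%:R <= (X n - X n.+1) * gpdf (X n).
Proof.
move=> hX nN; have [_ _ _ b2] := mw_psum_mills hX (ltnW nN).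
have /andP[_ q2] := mw_quantile hX (ltnW nN).
have S0 := mw_psum_gt0 hX nN.
have N0 : 0 < N%:R :> R by rewrite ltr0n; lia.
rewrite (mw_gap hX nN) ler_pdivlMl// mulrA mulrA mulrAC ler_pdivrMr ?ltr0n//.
rewrite [leRHS]mulrC; apply: le_trans b2; rewrite -mulrA ler_pM2l//.
rewrite lerBrDl -lerBrDr (le_trans q2)// lerBrDr -mulrDl -natrD subnK 1?ltnW 1?ltnW//.
by rewrite divff ?gt_eqF.
Qed.

End quantiles.

(** * Integrals of tents and of one-sided excesses *)

Section gauss_integrals.
Context {R : realType}.
Local Notation gauss := (normal_prob (0 : R) 1).
Local Notation mu := (@lebesgue_measure R).

(** The Radon-Nikodym derivative of [gauss] equals [gpdf] almost everywhere, as both have the same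
    integral over every measurable set. *)
Lemma ge0_integral_gauss (f : R -> \bar R) : (forall x, 0 <= f x)%E ->
  measurable_fun [set: R] f ->
  (\int[gauss]_x f x = \int[mu]_x (f x * (gpdf x)%:E))%E.
Proof.
move=> f0 mf.
have dom : gauss `<< mu by exact: normal_prob_dominates.
have mp : measurable_fun [set: R] (EFin \o gpdf).
  by apply/measurable_EFinP; exact: measurable_gpdf.
have iRN := Radon_Nikodym_SigmaFinite.f_integrable dom.
rewrite -(Radon_Nikodym_SigmaFinite.change_of_variables dom)//.
apply: ae_eq_integral => //.
- by apply: emeasurable_funM => //; exact: (measurable_int mu).
- exact: emeasurable_funM.
- apply: ae_eqe_mul2l; apply: integral_ae_eq => //= E _ mE.
  by rewrite -Radon_Nikodym_SigmaFinite.f_integral.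
Qed.

Lemma FTC2_everywhere (f F : R -> R) (a b : R) : a < b -> continuous f ->
  (forall x : R, is_derive x 1 F (f x)) ->
  (\int[mu]_(x in `[a, b]) (f x)%:E = (F b - F a)%:E)%E.
Proof.
move=> ab cf dF; have cF := is_derive_continuous dF.
rewrite (@continuous_FTC2 _ f F)//.
- exact: continuous_subspaceT.
- split.
  + by move=> x _; case: (dF x).
  + exact/cvg_at_right_filter/cF.
  + exact/cvg_at_left_filter/cF.
- by move=> x _; rewrite derive1E; have ? := dF x; rewrite derive_val.
Qed.

Definition tent (a b t : R) : R := Num.max 0 (Num.min (t - a) (b - t)).

Lemma tent_ge0 a b t : 0 <= tent a b t.
Proof. by rewrite /tent le_max lexx. Qed.

Lemma lip1_continuous (h : R -> R) :
  (forall x y, `|h x - h y| <= `|x - y|) -> continuous h.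
Proof.
move=> lh x; apply/cvgrPdist_lt => e e0; near=> y.
apply: le_lt_trans (lh _ _) _; near: y.
exact: (@cvgr_dist_lt _ _ _ _ _ id).
Unshelve. all: by end_near. Qed.

Lemma lip1_wlog (h : R -> R) :
  (forall x y, x <= y -> h x - h y <= y - x /\ h y - h x <= y - x) ->
  forall x y, `|h x - h y| <= `|x - y|.
Proof.
move=> lh x y; have [xy|/ltW yx] := leP x y.
  by rewrite (distrC x) (ger0_norm (x := y - x)) ?subr_ge0// ler_norml;
    have [] := lh _ _ xy; lra.
by rewrite (ger0_norm (x := x - y)) ?subr_ge0// ler_norml;
  have [] := lh _ _ yx; lra.
Qed.

Lemma lip1_tent a b x y : `|tent a b x - tent a b y| <= `|x - y|.
Proof.
move: x y; apply: lip1_wlog => x y xy; rewrite /tent.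
have [?|?] := leP (x - a) (b - x); have [?|?] := leP (y - a) (b - y);
  do 2![case: (leP 0) => ?]; split; lra.
Qed.

Lemma lip1_pos_part (a x y : R) : `|Num.max 0 (x - a) - Num.max 0 (y - a)| <= `|x - y|.
Proof.
move: x y; apply: (@lip1_wlog (fun x => Num.max 0 (x - a))) => x y xy.
by do 2![case: (leP 0) => ?]; split; lra.
Qed.

Lemma lip1_neg_part (a x y : R) : `|Num.max 0 (a - x) - Num.max 0 (a - y)| <= `|x - y|.
Proof.
move: x y; apply: (@lip1_wlog (fun x => Num.max 0 (a - x))) => x y xy.
by do 2![case: (leP 0) => ?]; split; lra.
Qed.

Lemma measurable_lip1 (h : R -> R) : (forall x y, `|h x - h y| <= `|x - y|) ->
  measurable_fun [set: R] (EFin \o h).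
Proof.
move=> lh; apply/measurable_EFinP; apply: continuous_measurable_fun.
exact: lip1_continuous.
Qed.

(** The area of a triangle, computed by cutting at the midpoint [c], where the minimum changes
    branch. *)
Lemma integral_tent a b : a < b ->
  (\int[mu]_(x in `[a, b]) (tent a b x)%:E = ((b - a) ^+ 2 / 4)%:E)%E.
Proof.
move=> ab; pose c := (a + b) / 2.
have ac : a < c by rewrite /c; lra.
have cb : c < b by rewrite /c; lra.
have mt : measurable_fun [set: R] (fun x => (tent a b x)%:E).
  by apply: measurable_lip1; exact: lip1_tent.
rewrite (@itv_bndbnd_setU _ _ (BLeft a) (BRight c) (BRight b)) ?bnd_simp ?ltW//.
rewrite ge0_integral_setU//=; last 3 first.
- exact: measurable_funTS.
- by move=> x _; rewrite lee_fin tent_ge0.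
- apply/disj_setPS => x [/=]; rewrite !in_itv/= => /andP[_ xc] /andP[cx _].
  by move: xc; rewrite leNgt cx.
rewrite integral_itv_obnd_cbnd; last exact: measurable_funTS.
have -> : (\int[mu]_(x in `[a, c]) (tent a b x)%:E =
           \int[mu]_(x in `[a, c]) (x - a)%:E)%E.
  apply: eq_integral => x; rewrite inE/= in_itv/= => /andP[ax xc].
  congr EFin; rewrite /tent min_l ?max_r//; move: xc; rewrite /c; lra.
have -> : (\int[mu]_(x in `[c, b]) (tent a b x)%:E =
           \int[mu]_(x in `[c, b]) (b - x)%:E)%E.
  apply: eq_integral => x; rewrite inE/= in_itv/= => /andP[cx xb].
  congr EFin; rewrite /tent min_r ?max_r//; move: cx; rewrite /c; lra.
have c1 : continuous (fun x : R => x - a).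
  by move=> x; apply: cvgB; [exact: cvg_id|exact: cvg_cst].
have c2 : continuous (fun x : R => b - x).
  by move=> x; apply: cvgB; [exact: cvg_cst|exact: cvg_id].
have d1 (x : R) : is_derive x 1 (fun x : R => (x - a) ^+ 2 / 2) (x - a).
  by apply: is_derive_eq; rewrite /GRing.scale/=; field.
have d2 (x : R) : is_derive x 1 (fun x : R => - (b - x) ^+ 2 / 2) (b - x).
  by apply: is_derive_eq; rewrite /GRing.scale/=; field.
rewrite (FTC2_everywhere ac c1 d1) (FTC2_everywhere cb c2 d2).
by rewrite -EFinD; congr EFin; rewrite /c; field.
Qed.

Lemma integral_gauss_tent_ge a b m : a < b -> 0 <= m ->
  (forall x, a <= x <= b -> m <= gpdf x) ->
  ((m * ((b - a) ^+ 2 / 4))%:E <= \int[gauss]_x (tent a b x)%:E)%E.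
Proof.
move=> ab m0 mp.
have mt : measurable_fun [set: R] (fun x => (tent a b x)%:E).
  by apply: measurable_lip1; exact: lip1_tent.
have mg : measurable_fun [set: R] (EFin \o gpdf).
  by apply/measurable_EFinP; exact: measurable_gpdf.
rewrite ge0_integral_gauss//; last by move=> x; rewrite lee_fin tent_ge0.
rewrite EFinM -integral_tent// -ge0_integralZl//; last 2 first.
- exact: measurable_funTS.
- by move=> x _; rewrite lee_fin tent_ge0.
apply: (@le_trans _ _ (\int[mu]_(x in `[a, b]) ((tent a b x)%:E * (gpdf x)%:E))%E).
  apply: ge0_le_integral => //.
  - by move=> x _; rewrite -EFinM lee_fin mulr_ge0// tent_ge0.
  - by apply: emeasurable_funM => //; exact: measurable_funTS.
  - by apply: emeasurable_funM => //; exact: measurable_funTS.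
  - move=> x /=; rewrite in_itv/= => xab.
    by rewrite -!EFinM lee_fin mulrC ler_wpM2l ?tent_ge0// mp.
apply: ge0_subset_integral => //.
- exact: emeasurable_funM.
- by move=> x _; rewrite -EFinM lee_fin mulr_ge0 ?tent_ge0// ltW ?gpdf_gt0.
Qed.

Lemma integral_gauss_tail (a : R) :
  (\int[mu]_(x in `[a, +oo[) ((x - a) * gpdf x)%:E =
   (- a * gcdf (- a) + gpdf (- a))%:E)%E.
Proof.
have dF (x : R) : is_derive x 1 (fun y => - gpdf y - a * gcdf y) ((x - a) * gpdf x).
  have ? := is_derive_gcdf x; have ? := is_derive_gpdf x.
  by apply: is_derive_eq; rewrite /GRing.scale/=; ring.
(* The last argument [- a] is the limit of the antiderivative at +oo. *)
rewrite (@ge0_continuous_FTC2y _ _ (fun y => - gpdf y - a * gcdf y) _ (- a)).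
- by rewrite -EFinB gcdfN gpdfN; congr EFin; ring.
- by move=> x ax; rewrite mulr_ge0 ?subr_ge0// ltW ?gpdf_gt0.
- apply: continuous_subspaceT => x; apply: cvgM; last exact: continuous_gpdf.
  by apply: cvgB; [exact: cvg_id|exact: cvg_cst].
- rewrite -[- a](_ : - 0 - a * 1 = _); last by rewrite oppr0 mulr1 add0r.
  apply: cvgB; last by apply: cvgMr; exact: cvg_gcdfy1.
  apply: cvgN; have := @cvgNy_Xgpdf R 0; move/cvgNy_compNP.
  by under eq_fun do rewrite /= expr0 mul1r gpdfN.
- by move=> x _; case: (dF x).
- by apply: cvg_at_right_filter; exact: (is_derive_continuous dF).
- by move=> x _; rewrite derive1E; have ? := dF x; rewrite derive_val.
Qed.

Lemma integral_gauss_upper_tail (a : R) :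
  (\int[gauss]_x (Num.max 0 (x - a))%:E =
   (- a * gcdf (- a) + gpdf (- a))%:E)%E.
Proof.
rewrite ge0_integral_gauss; last 2 first.
- by move=> x; rewrite lee_fin le_max lexx.
- by apply: measurable_lip1; exact: lip1_pos_part.
rewrite -integral_gauss_tail [RHS]integral_mkcond.
apply: eq_integral => x _; rewrite patchE mem_setE in_itv/= andbT -EFinM.
case: leP => ax; first by rewrite max_r// subr_ge0.
by rewrite max_l ?mul0r// subr_le0 ltW.
Qed.

Lemma integral_gauss_lower_tail (a : R) :
  (\int[gauss]_x (Num.max 0 (a - x))%:E = (a * gcdf a + gpdf a)%:E)%E.
Proof.
rewrite ge0_integral_gauss; last 2 first.
- by move=> x; rewrite lee_fin le_max lexx.
- by apply: measurable_lip1; exact: lip1_neg_part.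
(* The end point is written [- - a] to fit the substitution of [- x] for [x], which leads back to
   the upper tail. *)
transitivity (\int[mu]_(x in `]-oo, (- - a)%R]) ((a - x) * gpdf x)%:E)%E.
  rewrite opprK [RHS]integral_mkcond.
  apply: eq_integral => x _; rewrite patchE mem_setE in_itv/= -EFinM.
  case: leP => ax; first by rewrite max_r// subr_ge0.
  by rewrite max_l ?mul0r// subr_le0 ltW.
rewrite ge0_integration_by_substitutionNy.
- rewrite -[in RHS](opprK a) -integral_gauss_tail.
  apply: eq_integral => x _ /=; rewrite gpdfN; congr (_ * _)%:E; ring.
- apply: continuous_subspaceT => x; apply: cvgM; last exact: continuous_gpdf.
  by apply: cvgB; [exact: cvg_cst|exact: cvg_id].
- move=> x; rewrite opprK in_itv/= => xa.
  by rewrite mulr_ge0 ?subr_ge0 ?ltW ?gpdf_gt0.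
Qed.

End gauss_integrals.

(** * The two distances *)

Section has_integral.
Context d (T : measurableType d) (R : realType).
Variable m : {measure set T -> \bar R}.
Implicit Types (f g : T -> R) (u v : R).

(** Carrying integrability together with the value lets linearity be applied term by term. *)
Definition has_integral f v :=
  m.-integrable [set: T] (EFin \o f) /\ (\int[m]_x (f x)%:E = v%:E)%E.

Lemma has_integralD f g u v : has_integral f u -> has_integral g v ->
  has_integral (fun x => f x + g x) (u + v).
Proof.
move=> [fi fu] [gi gv]; split.
  by have := integrableD measurableT fi gi.
under eq_integral do rewrite EFinD.
by rewrite integralD// fu gv.
Qed.

Lemma has_integralZ (c : R) f u : has_integral f u ->
  has_integral (fun x => c * f x) (c * u).
Proof.
move=> [fi fu]; split; first by have := integrableZl measurableT c fi.
under eq_integral do rewrite EFinM.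
by rewrite integralZl// fu.
Qed.

Lemma has_integral_sum n (F : 'I_n -> T -> R) (V : 'I_n -> R) :
  (forall i, has_integral (F i) (V i)) ->
  has_integral (fun x => \sum_(i < n) F i x) (\sum_(i < n) V i).
Proof.
elim: n F V => [|n IHn] F V FV.
  have -> : (fun x => \sum_(i < 0) F i x) = cst 0.
    by apply/funext => x; rewrite big_ord0.
  by rewrite big_ord0; split; [exact: integrable0|rewrite integral0].
rewrite big_ord_recr; under eq_fun do rewrite big_ord_recr.
exact: has_integralD (IHn _ _ (fun i => FV _)) (FV _).
Qed.

Lemma ge0_has_integral f v : (forall x, 0 <= f x) ->
  measurable_fun [set: T] (EFin \o f) -> (\int[m]_x (f x)%:E = v%:E)%E ->
  has_integral f v.
Proof.
move=> f0 mf fv; split=> //; apply/integrableP; split=> //.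
under eq_integral do rewrite gee0_abs ?lee_fin//.
by rewrite fv ltry.
Qed.

Lemma dominated_has_integral f g v : measurable_fun [set: T] (EFin \o f) ->
  (forall x, `|f x| <= g x) -> has_integral g v ->
  exists2 u, has_integral f u & `|u| <= v.
Proof.
move=> mf fg [gi gv].
have g0 x : 0 <= g x by exact: le_trans (fg x).
have fi : m.-integrable [set: T] (EFin \o f).
  apply: le_integrable gi => // x _ /=.
  by rewrite lee_fin (ger0_norm (g0 x)).
have fin := integrable_fin_num measurableT fi.
exists (fine (\int[m]_x (f x)%:E)%E); first by split=> //; rewrite fineK.
rewrite -lee_fin -[leLHS]/(abse (fine _)%:E) fineK// -gv.
apply: (le_trans (le_abse_integral _ _ _)) => //.
apply: ge0_le_integral => //.
- exact: measurableT_comp.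
- exact: measurable_int gi.
- by move=> x _ /=; rewrite lee_fin.
Qed.

End has_integral.

Section finite_sums.
Context {R : realType}.

Lemma Abel_sum (g : nat -> R) (m : nat) :
  \sum_(i < m.+1) g i =
  m.+1%:R * g m + \sum_(i < m) (g i - g i.+1) * i.+1%:R.
Proof.
elim: m => [|m IHm]; first by rewrite big_ord1 big_ord0 mul1r addr0.
rewrite big_ord_recr/= IHm [in RHS]big_ord_recr/=.
by rewrite -[m.+2%:R]natr1; ring.
Qed.

Lemma telescope_ord (g : nat -> R) (m : nat) :
  \sum_(i < m) (g i - g i.+1) = g 0 - g m.
Proof.
elim: m => [|m IHm]; first by rewrite big_ord0 subrr.
by rewrite big_ord_recr/= IHm addrA subrK.
Qed.

End finite_sums.

(** * Upper Wasserstein bound by step functions *)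

Section wasserstein_upper.
Context {R : realType}.
Local Notation gauss := (normal_prob (0 : R) 1).

Lemma has_integral_gauss_gt (a : R) :
  has_integral gauss (fun t => (a < t)%R%:R) (1 - gcdf a).
Proof.
have E : (fun t : R => ((a < t)%R%:R : R)%:E) = (fun t => (\1_`]a, +oo[ t)%:E).
  apply/funext => t; rewrite indicE; congr (_%:R%:E); congr nat_of_bool.
  by rewrite mem_setE in_itv/= andbT.
split; first by rewrite /comp E; exact: integrable_indic.
by rewrite E integral_indic// setIT; exact: gauss_itvoy.
Qed.

Lemma has_integral_gauss_cst (c : R) : has_integral gauss (fun=> c) c.
Proof.
have g1 : gauss [set: R] = 1%E by exact: probability_setT.
split; first exact: finite_measure_integrable_cst.
by rewrite integral_cst//=; rewrite g1 mule1.
Qed.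

Variables (N : nat) (X : nat -> R).
Hypotheses (N1 : (1 < N)%N) (hX : mw_solution N X).

Let M := N.-1.
Let MN : (M < N)%N. Proof. by rewrite /M; lia. Qed.
Let N0 : 0 < N%:R :> R. Proof. by rewrite ltr0n; lia. Qed.
Let MN2 i : (i < M)%N -> (i.+1 < N)%N. Proof. by rewrite /M; lia. Qed.

Let le_X i : (i < M)%N -> X i.+1 <= X i.
Proof. by move=> /MN2 iN; exact/ltW/(mw_decr hX). Qed.

Let le_XM i : (i <= M)%N -> X M <= X i.
Proof. by move=> iM; rewrite (mw_nonincr hX)// iM MN. Qed.

(** Only the cell with [X i.+1 < t <= X i] contributes, by at most its gap; outside the range of the
    atoms the error is the overshoot. The coefficient [-1] keeps the bound in the shape of
    [has_integralD] and [has_integralZ]. *)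
Lemma mw_step_approx (h : R -> R) :
  (forall x y, `|h x - h y| <= `|x - y|) -> forall t,
  `|h t - (h (X M) + \sum_(i < M) (h (X i) - h (X i.+1)) * (X i.+1 < t)%R%:R)| <=
  \sum_(i < M) (X i - X i.+1) * ((X i.+1 < t)%R%:R + -1 * (X i < t)%R%:R) +
  (Num.max 0 (t - X 0) + Num.max 0 (X M - t)).
Proof.
(* The values [h (u i)] telescope from [u 0], the point of [[X M, X 0]] nearest to [t], down to
   [X M]. *)
move=> lh t; pose u i := Num.max (X M) (Num.min t (X i)).
have uM : u M = X M by rewrite /u max_l// ge_min lexx orbT.
have term i : (i < M)%N ->
  `|h (u i) - h (u i.+1) - (h (X i) - h (X i.+1)) * (X i.+1 < t)%R%:R| <=
  (X i - X i.+1) * ((X i.+1 < t)%R%:R + -1 * (X i < t)%R%:R).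
  move=> iM; have xi := le_X iM; have xM := le_XM iM; have xM' := le_XM (ltnW iM).
  have [t1|t1] := leP t (X i.+1).
    rewrite /u ltNge (le_trans t1 xi)/= !min_l ?(le_trans t1 xi)//.
    by rewrite !subrr mulr0 subr0 mulr0 addr0 mulr0 normr0.
  have u1 : u i.+1 = X i.+1 by rewrite /u min_r ?ltW// max_r.
  have [t2|t2] := leP t (X i).
    have -> : u i = t by rewrite /u min_l// max_r// (le_trans xM)// ltW.
    rewrite u1 mulr1 mulr0 addr0 mulr1.
    have -> : h t - h (X i.+1) - (h (X i) - h (X i.+1)) = h t - h (X i) by lra.
    rewrite (le_trans (lh _ _))// distrC ger0_norm ?subr_ge0//; lra.
  have -> : u i = X i by rewrite /u min_r ?ltW// max_r.
  by rewrite u1 !mulr1 subrr normr0 subrr mulr0.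
have tail : `|h t - h (u 0)| <= Num.max 0 (t - X 0) + Num.max 0 (X M - t).
  apply: le_trans (lh _ _) _; rewrite /u.
  have xM : X M <= X 0 by exact: le_XM.
  have [t0|t0] := leP t (X 0).
    have [tM|tM] := leP (X M) t; first by rewrite subrr normr0 addr_ge0// le_max lexx.
    have {}tM := ltW tM.
    rewrite (max_l (y := t - X 0)) ?subr_le0// add0r max_r ?subr_ge0//.
    by rewrite distrC ger0_norm// subr_ge0.
  have {}t0 := ltW t0; rewrite max_r// (max_r (y := t - X 0)) ?subr_ge0//.
  by rewrite ger0_norm ?subr_ge0// lerDl le_max lexx.
have -> : h t - (h (X M) + \sum_(i < M) (h (X i) - h (X i.+1)) * (X i.+1 < t)%R%:R) =
  \sum_(i < M) (h (u i) - h (u i.+1) - (h (X i) - h (X i.+1)) * (X i.+1 < t)%R%:R)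
  + (h t - h (u 0)).
  rewrite sumrB (telescope_ord (fun i => h (u i))) uM; ring.
apply: (le_trans (ler_normD _ _)); apply: lerD => //.
apply: (le_trans (ler_norm_sum _ _ _)); apply: ler_sum => i _; exact: term.
Qed.

(** The error splits into that of replacing [h] by the step function [s], at most [gv], and the
    difference between the atomic mean and the normal integral [sv] of [s]. *)
Lemma mw_wasserstein_le (h : R -> R) :
  (forall x y, `|h x - h y| <= `|x - y|) ->
  exists2 v, (\int[gauss]_t (h t)%:E = v%:E)%E &
    `|(\sum_(i < N) h (X i)) / N%:R - v| <= (3 * (X 0 - X M) + 2) / N%:R.
Proof.
move=> lh.
pose s t := h (X M) + \sum_(i < M) (h (X i) - h (X i.+1)) * (X i.+1 < t)%R%:R.
pose sv := h (X M) + \sum_(i < M) (h (X i) - h (X i.+1)) * (1 - gcdf (X i.+1)).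
have hs : has_integral gauss s sv.
  apply: has_integralD; first exact: has_integral_gauss_cst.
  by apply: has_integral_sum => i; apply: has_integralZ; exact: has_integral_gauss_gt.
pose g t := \sum_(i < M) (X i - X i.+1) * ((X i.+1 < t)%R%:R + -1 * (X i < t)%R%:R) +
  (Num.max 0 (t - X 0) + Num.max 0 (X M - t)).
pose gv := \sum_(i < M) (X i - X i.+1) *
    ((1 - gcdf (X i.+1)) + -1 * (1 - gcdf (X i))) +
  ((- X 0 * gcdf (- X 0) + gpdf (- X 0)) + (X M * gcdf (X M) + gpdf (X M))).
have hg : has_integral gauss g gv.
  apply: has_integralD.
    apply: has_integral_sum => i; apply: has_integralZ; apply: has_integralD.
      exact: has_integral_gauss_gt.
    by apply: has_integralZ; exact: has_integral_gauss_gt.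
  apply: has_integralD; apply: ge0_has_integral.
  - by move=> t; rewrite le_max lexx.
  - by apply: measurable_lip1; exact: lip1_pos_part.
  - exact: integral_gauss_upper_tail.
  - by move=> t; rewrite le_max lexx.
  - by apply: measurable_lip1; exact: lip1_neg_part.
  - exact: integral_gauss_lower_tail.
have mhs : measurable_fun [set: R] (EFin \o (fun t => h t + -1 * s t)).
  apply/measurable_EFinP/measurable_funD.
    by apply/measurable_EFinP; exact: measurable_lip1.
  apply: measurable_funM => //; apply/measurable_EFinP.
  by case: hs => si _; exact: measurable_int si.
have [|u hu u_le] := @dominated_has_integral _ _ _ gauss _ _ _ mhs _ hg.
  by move=> t; rewrite mulN1r; exact: mw_step_approx.
have [_ hE] := has_integralD hs hu.
exists (sv + u).
  by rewrite -hE; apply: eq_integral => t _; congr EFin; rewrite mulN1r addrC subrK.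
have q i : (i < N)%N -> (N - i.+1)%:R / N%:R <= gcdf (X i) <= (N - i)%:R / N%:R.
  exact: mw_quantile.
have nat_sub i : (i <= N)%N -> (N - i)%:R / N%:R = 1 - i%:R / N%:R :> R.
  by move=> iN; rewrite natrB// mulrBl divff ?gt_eqF.
(* By [mw_quantile] each cell has mass at most 2/N; each tail contributes at most 1/N. *)
have gv_le : gv <= (2 * (X 0 - X M) + 2) / N%:R.
  rewrite /gv mulrDl; apply: lerD.
    rewrite -telescope_ord mulr_sumr mulr_suml; apply: ler_sum => i _.
    have iM := ltn_ord i; rewrite [2 * _]mulrC -mulrA.
    apply: ler_wpM2l; first by rewrite subr_ge0 le_X.
    have iN := MN2 iM.
    have /andP[_ q1] := q i (leq_trans (leqnSn _) iN).
    have /andP[q2 _] := q i.+1 iN.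
    move: q1 q2; rewrite !nat_sub// 1?ltnW 1?ltnW//.
    rewrite -[i.+2%:R]natr1 -[i.+1%:R]natr1 !mulrDl !mul1r; lra.
  rewrite -[2]/(1 + 1) mulrDl; apply: lerD.
    have x0 : - X 0 <= 0 by rewrite oppr_le0 ltW// (mw_first_gt0 N1 hX).
    apply: (le_trans (gauss_tail_le x0)); rewrite gcdfN.
    have /andP[q1 _] := q 0%N (ltnW N1).
    by move: q1; rewrite nat_sub 1?ltnW//; lra.
  have x0 : X M <= 0 by rewrite ltW// (mw_last_lt0 N1 hX).
  apply: (le_trans (gauss_tail_le x0)).
  have /andP[_ q1] := q M MN.
  by apply: le_trans q1 _; rewrite (_ : (N - M = 1)%N)// /M; lia.
(* Summation by parts writes both sides through the increments of [h], with weights that differ by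
   at most 1/N. *)
have sv_le : `|(\sum_(i < N) h (X i)) / N%:R - sv| <= (X 0 - X M) / N%:R.
  have -> : \sum_(i < N) h (X i) =
      N%:R * h (X M) + \sum_(i < M) (h (X i) - h (X i.+1)) * i.+1%:R.
    have := Abel_sum (fun i => h (X i)) M.
    by rewrite (_ : M.+1 = N)// /M prednK// ltnW.
  have -> : (N%:R * h (X M) + \sum_(i < M) (h (X i) - h (X i.+1)) * i.+1%:R) / N%:R
      - sv = \sum_(i < M) (h (X i) - h (X i.+1)) *
               (i.+1%:R / N%:R - (1 - gcdf (X i.+1))).
    rewrite /sv mulrDl mulrAC divff ?gt_eqF// mul1r mulr_suml.
    under [in RHS]eq_bigr do rewrite mulrBr mulrA.
    by rewrite sumrB opprD addrACA subrr add0r.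
  apply: (le_trans (ler_norm_sum _ _ _)).
  rewrite -telescope_ord mulr_suml; apply: ler_sum => i _.
  have iM := ltn_ord i; have iN := MN2 iM.
  rewrite normrM; apply: ler_pM => //.
    by rewrite (le_trans (lh _ _))// ger0_norm// subr_ge0 le_X.
  have /andP[q1 q2] := q i.+1 iN.
  move: q1 q2; rewrite !nat_sub// 1?ltnW//.
  by rewrite -[i.+2%:R]natr1 mulrDl mul1r ler_norml => q1 q2; apply/andP; split; lra.
rewrite opprD addrA; apply: (le_trans (ler_normB _ _)).
apply: (le_trans (lerD sv_le (le_trans u_le gv_le))).
by rewrite -mulrDl ler_pM2r ?invr_gt0//; lra.
Qed.

Lemma mw_range_le : (3 * (X 0 - X M) + 2) / N%:R <=
  16 * Num.sqrt (ln N%:R) / N%:R.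
Proof.
rewrite ler_pM2r ?invr_gt0//.
have h1 := mw_first_sqr_le N1 hX.
have h2 := mw_first_sqr_le N1 (mw_rev_solution hX).
rewrite /mw_rev subn0 sqrrN -/M in h2.
have a0 := mw_first_gt0 N1 hX; have b0 := mw_last_lt0 N1 hX.
have L0 : 2 / 3 <= ln N%:R :> R.
  by rewrite (le_trans ln2_ge)// ler_ln ?posrE// ler_nat.
have q0 := sqrtr_ge0 (ln N%:R : R).
have : Num.sqrt (ln N%:R) ^+ 2 = ln N%:R :> R by rewrite sqr_sqrtr//; lra.
move: (Num.sqrt (ln N%:R)) q0 => q q0 qE.
(* This is the value at which 3 (9/2) q + 2 <= 16 q holds; the factor 9/4 below works since 2 + 2
   q^2 <= (9/4)^2 q^2 when q^2 >= 2/3. *)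
have q8 : 8 / 10 <= q by rewrite leNgt; apply/negP => qlt; nra.
have c1 : X 0 <= 9 / 4 * q by rewrite leNgt; apply/negP => qlt; nra.
have c2 : - X M <= 9 / 4 * q.
  by rewrite leNgt; apply/negP => qlt; rewrite /M in b0 *; nra.
lra.
Qed.

End wasserstein_upper.

(** * Lower Wasserstein bound by a sum of tents *)

Section wasserstein_lower.
Context {R : realType}.
Local Notation gauss := (normal_prob (0 : R) 1).

Lemma gpdf_le_of_norm (x y : R) : `|x| <= `|y| -> gpdf y <= gpdf x.
Proof.
move=> xy; rewrite !gpdfE ler_pM2l ?normal_peak_gt0 ?oner_neq0// ler_expR.
have : x ^+ 2 <= y ^+ 2.
  rewrite -[x ^+ 2]real_normK ?num_real// -[y ^+ 2]real_normK ?num_real//.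
  by rewrite lerXn2r// nnegrE.
lra.
Qed.

(** Both functions vanish at [c], so an increment across [c] is split there. *)
Lemma lip1_glue (f g : R -> R) (c : R) :
  (forall x y, `|f x - f y| <= `|x - y|) ->
  (forall x y, `|g x - g y| <= `|x - y|) ->
  (forall x, x <= c -> f x = 0) -> (forall x, c <= x -> g x = 0) ->
  forall x y, `|(f x + g x) - (f y + g y)| <= `|x - y|.
Proof.
move=> lf lg f0 g0; apply: (@lip1_wlog _ (fun x => f x + g x)) => x y xy.
have := lf x y; have := lg x y; have := lf c y; have := lg x c.
rewrite !(distrC x) (ger0_norm (x := y - x)) ?subr_ge0// !ler_norml.
have [cx|/ltW xc] := leP c x.
  by rewrite (g0 x)// (g0 y) ?(le_trans cx)//; split; lra.
have [yc|/ltW cy] := leP y c.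
  by rewrite (f0 x)// (f0 y)//; split; lra.
rewrite (f0 x)// (f0 c)// (g0 y)// (g0 c)//.
by rewrite (distrC c y) (ger0_norm (x := y - c)) ?(ger0_norm (x := c - x)) ?subr_ge0//;
  split; lra.
Qed.

Lemma tent_out (a b t : R) : (t <= a) || (b <= t) -> tent a b t = 0.
Proof.
move=> tab; rewrite /tent max_l// ge_min !subr_le0.
by case/orP: tab => ->; rewrite ?orbT.
Qed.

Variables (N : nat) (X : nat -> R).
Hypotheses (N1 : (1 < N)%N) (hX : mw_solution N X).

Let M := N.-1.
Let N0 : 0 < N%:R :> R. Proof. by rewrite ltr0n; lia. Qed.
Let MN i : (i < M)%N -> (i.+1 < N)%N. Proof. by rewrite /M; lia. Qed.

Definition mw_tents (t : R) : R := \sum_(i < N.-1) tent (X i.+1) (X i) t.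

Lemma mw_tents_lip1 x y : `|mw_tents x - mw_tents y| <= `|x - y|.
Proof.
(* The induction also carries vanishing to the left of [X m], which [lip1_glue] needs. *)
have gen m : (m <= M)%N -> (forall x y,
    `|\sum_(i < m) tent (X i.+1) (X i) x - \sum_(i < m) tent (X i.+1) (X i) y|
      <= `|x - y|) /\
  (forall x, x <= X m -> \sum_(i < m) tent (X i.+1) (X i) x = 0).
  elim: m => [|m IHm] mM; first by split=> *; rewrite !big_ord0// subrr normr0.
  have [ih1 ih2] := IHm (ltnW mM); have xm := ltW (mw_decr hX (MN mM)).
  split=> [{}x {}y|t tm].
    rewrite !big_ord_recr/=.
    apply: (@lip1_glue _ (tent (X m.+1) (X m)) (X m)) ih1 _ ih2 _ _ _.
      exact: lip1_tent.
    by move=> t mt; rewrite tent_out// mt orbT.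
  rewrite big_ord_recr/= ih2 ?(le_trans tm)// add0r tent_out//.
  by rewrite tm.
by have [lip _] := gen M (leqnn _); exact: lip.
Qed.

Lemma mw_tents_atom n : (n < N)%N -> mw_tents (X n) = 0.
Proof.
move=> nN; apply: big1 => i _; have iN := MN (ltn_ord i).
apply: tent_out; have [ni|ni] := leqP n i.
  by apply/orP; right; apply: (mw_nonincr hX); rewrite ni ltnW.
by apply/orP; left; apply: (mw_nonincr hX); rewrite ni.
Qed.

(** One factor of the squared gap is absorbed by the density [p]; the other remains to be summed. *)
Let tent_gap i (p w : R) : (i < M)%N -> 0 <= p ->
  (forall t, X i.+1 <= t <= X i -> p <= gpdf t) ->
  w / N%:R <= (X i - X i.+1) * p ->
  (((X i - X i.+1) * w / (4 * N%:R))%:E <=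
   \int[gauss]_t (tent (X i.+1) (X i) t)%:E)%E.
Proof.
move=> iM p0 pt wp; have g0 := mw_decr hX (MN iM).
apply: le_trans (integral_gauss_tent_ge g0 p0 pt); rewrite lee_fin.
have -> : (X i - X i.+1) * w / (4 * N%:R) = (X i - X i.+1) / 4 * (w / N%:R).
  by field; rewrite gt_eqF.
have -> : p * ((X i - X i.+1) ^+ 2 / 4) =
  (X i - X i.+1) / 4 * ((X i - X i.+1) * p) by ring.
by rewrite ler_pM2l// divr_gt0// subr_gt0.
Qed.

(** To the right of 0 the density is least at the upper end point, where [mw_gap_density]
    applies. *)
Let upper_gap i : (i < M)%N -> 0 <= X i.+1 ->
  (((X i - X i.+1) * (i%:R / i.+1%:R) / (4 * N%:R))%:E <=
   \int[gauss]_t (tent (X i.+1) (X i) t)%:E)%E.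
Proof.
move=> iM xi; apply: (@tent_gap _ (gpdf (X i))) => //.
- by rewrite ltW ?gpdf_gt0.
- move=> t /andP[t1 t2]; apply: gpdf_le_of_norm.
  have t0 := le_trans xi t1.
  by rewrite !ger0_norm// (le_trans t0).
- exact: mw_gap_density hX (MN iM).
Qed.

Let lower_gap i : (i < M)%N -> X i <= 0 ->
  (((X i - X i.+1) * ((M - i.+1)%:R / (M - i.+1).+1%:R) / (4 * N%:R))%:E <=
   \int[gauss]_t (tent (X i.+1) (X i) t)%:E)%E.
Proof.
move=> iM xi; apply: (@tent_gap _ (gpdf (X i.+1))) => //.
- by rewrite ltW ?gpdf_gt0.
- move=> t /andP[t1 t2]; apply: gpdf_le_of_norm.
  have t0 := le_trans t2 xi.
  by rewrite !ler0_norm ?lerN2// (le_trans t1).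
- have jN : ((M - i.+1).+1 < N)%N by rewrite /M in iM *; lia.
  have := mw_gap_density (mw_rev_solution hX) jN; rewrite /mw_rev.
  have -> : (N.-1 - (M - i.+1) = i.+1)%N by rewrite /M in iM *; lia.
  have -> : (N.-1 - (M - i.+1).+1 = i)%N by rewrite /M in iM *; lia.
  by rewrite opprK gpdfN [- X i.+1 + _]addrC.
Qed.

(** [U] collects the gaps above 0 and [V] those below; a gap straddling 0 is discarded. Each side
    loses 3 in [mw_upper_gaps_ge], hence the 6. *)
Lemma mw_tents_integral_ge :
  (((X 0 - X N.-1 - 6) / (4 * N%:R))%:E <= \int[gauss]_t (mw_tents t)%:E)%E.
Proof.
have -> : (\int[gauss]_t (mw_tents t)%:E =
           \sum_(i < M) \int[gauss]_t (tent (X i.+1) (X i) t)%:E)%E.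
  under eq_integral do rewrite -sumEFin.
  rewrite ge0_integral_sum//.
  - by move=> i; apply: measurable_lip1; exact: lip1_tent.
  - by move=> i t _; rewrite lee_fin tent_ge0.
pose U (i : 'I_M) : R :=
  if 0 <= X i.+1 then (X i - X i.+1) * (i%:R / i.+1%:R) else 0.
pose V (i : 'I_M) : R := if X i <= 0 then
  (X i - X i.+1) * ((M - i.+1)%:R / (M - i.+1).+1%:R) else 0.
apply: (@le_trans _ _ (\sum_(i < M) ((U i + V i) / (4 * N%:R))%:E)%E); last first.
  apply: lee_sum => i _; have iM := ltn_ord i.
  have g0 := mw_decr hX (MN iM).
  rewrite /U /V; case: ifPn => c1; case: ifPn => c2.
  - by exfalso; lra.
  - by rewrite addr0; exact: upper_gap.
  - by rewrite add0r; exact: lower_gap.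
  - rewrite addr0 mul0r; apply: integral_ge0 => t _.
    by rewrite lee_fin tent_ge0.
rewrite sumEFin lee_fin -mulr_suml ler_pM2r ?invr_gt0 ?mulr_gt0//.
rewrite big_split/=.
have sU := mw_upper_gaps_ge N1 hX.
have sV := mw_upper_gaps_ge N1 (mw_rev_solution hX).
have UE : \sum_(i < M) U i =
    \sum_(i < N.-1 | 0 <= X i.+1) (X i - X i.+1) * (i%:R / i.+1%:R).
  by rewrite [RHS]big_mkcond.
have VE : \sum_(i < M) V i = \sum_(i < N.-1 | 0 <= mw_rev N X i.+1)
    (mw_rev N X i - mw_rev N X i.+1) * (i%:R / i.+1%:R).
  rewrite [RHS](reindex_inj rev_ord_inj) [RHS]big_mkcond/=.
  apply: eq_bigr => i _; have iM := ltn_ord i; rewrite /V /mw_rev.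
  have -> : (N.-1 - (N.-1 - i.+1) = i.+1)%N by rewrite /M in iM *; lia.
  have -> : (N.-1 - (N.-1 - i.+1).+1 = i)%N by rewrite /M in iM *; lia.
  by rewrite oppr_ge0 opprK [- X i.+1 + _]addrC.
rewrite UE VE; move: sU sV; rewrite {1}/mw_rev subn0; lra.
Qed.

End wasserstein_lower.

(** * Transfer to the empirical measure *)

Section empirical_theory.
Context {R : realType} (N : nat) (x : 'I_N -> R).

(* The value beyond [N] is the junk value [0]. *)
Definition ord_extend (k : nat) : R := oapp x 0 (insub k).

Local Notation X := ord_extend.

Lemma ord_extendE (i : 'I_N) : X i = x i.
Proof. by rewrite /ord_extend valK. Qed.

Lemma ord_extend_solution : strictly_decreasing x -> \sum_(n < N) x n = 0 ->
  satisfies_recursion x -> mw_solution N X.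
Proof.
move=> dx sx rx.
have ext n (nN : (n < N)%N) : X n = x (Ordinal nN).
  by rewrite -(ord_extendE (Ordinal nN)).
split=> [n nN||n nN].
- by rewrite (ext _ nN) (ext _ (ltnW nN)) dx.
- by rewrite /psum -[RHS]sx; apply: eq_bigr => i _; exact: ord_extendE.
- rewrite (ext _ nN) (ext _ (ltnW nN)) (rx (Ordinal (ltnW nN)) (Ordinal nN))//.
  rewrite div1r; congr (_ - _^-1).
  rewrite /psum (big_ord_widen _ X (ltnW nN)).
  by apply: eq_big => i; [rewrite ltnS|rewrite ord_extendE].
Qed.

Lemma ge0_integral_empirical (f : R -> \bar R) : (forall t, 0 <= f t)%E ->
  measurable_fun [set: R] f ->
  (\int[empirical x]_t f t = (N%:R^-1)%:E * \sum_(i < N) f (x i))%E.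
Proof.
move=> f0 mf; have invN0 : 0 <= N%:R^-1 :> R by rewrite invr_ge0.
pose atoms (k : nat) : {measure set (measurableTypeR R) -> \bar R} :=
  \d_(X k : measurableTypeR R).
(* The empirical measure is a scaled sum of Dirac masses, whose integrals are evaluations. *)
rewrite (@eq_measure_integral _ _ _ _ (mscale (NngNum invN0) (msum atoms N))).
  rewrite ge0_integral_mscale// ge0_integral_measure_sum//.
  congr (_ * _)%E; apply: eq_bigr => i _.
  by rewrite integral_dirac// diracT mul1e ord_extendE.
move=> A mA _; rewrite /= /mscale /empirical /= /msum.
rewrite (eq_bigr (fun k : 'I_N => ((x k \in A)%:R : R)%:E)); last first.
  by move=> k _; rewrite /atoms /= diracE ord_extendE.
rewrite sumEFin -EFinM mulrC -natr_sum; congr (_ * _%:R)%:E.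
by rewrite -sum1_card big_mkcond; apply: eq_bigr => k _; rewrite inE; case: ifP.
Qed.

Lemma integral_empirical (h : R -> R) : measurable_fun [set: R] (EFin \o h) ->
  (\int[empirical x]_t (h t)%:E = ((\sum_(i < N) h (x i)) / N%:R)%:E)%E.
Proof.
move=> mh; rewrite integralE !ge0_integral_empirical//; last 2 first.
- exact: measurable_funeneg.
- exact: measurable_funepos.
have -> : (\sum_(i < N) (EFin \o h)^\+ (x i) =
           (\sum_(i < N) Num.max (h (x i)) 0)%:E)%E.
  by rewrite -sumEFin; apply: eq_bigr => i _; rewrite funeposE EFin_max.
have -> : (\sum_(i < N) (EFin \o h)^\- (x i) =
           (\sum_(i < N) Num.max (- h (x i)) 0)%:E)%E.
  by rewrite -sumEFin; apply: eq_bigr => i _; rewrite funenegE EFin_max.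
rewrite -!EFinM -EFinB -mulrBr mulrC -sumrB; congr (_ * _)%:E.
apply: eq_bigr => i _; case: (leP (h (x i)) 0) => hi.
  by rewrite max_l ?oppr_ge0// sub0r opprK.
by rewrite max_r ?subr0// oppr_le0 ltW.
Qed.

Lemma empirical_ray (z : R) (j : nat) :
  (forall n, (n < N)%N -> (X n <= z) = (j <= n)%N) ->
  empirical x `]-oo, z] = ((N - j)%:R / N%:R)%:E.
Proof.
move=> hj; rewrite /empirical; congr (_%:R / _)%:E.
rewrite -sum1_card -[RHS]muln1 -sum_nat_const_nat big_geq_mkord.
apply: eq_bigl => i; rewrite inE mem_setE in_itv/= -ord_extendE.
exact: hj.
Qed.

Lemma mw_threshold (z : R) : mw_solution N X ->
  exists2 j, (j <= N)%N & forall n, (n < N)%N -> (X n <= z) = (j <= n)%N.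
Proof.
(* The disjunct [N <= n] yields the threshold [N] when [z] lies below every atom. *)
move=> hX; have exP : exists n, (N <= n)%N || (X n <= z).
  by exists N; rewrite leqnn.
case: (ex_minnP exP) => j Pj jmin; exists j; first by apply: jmin; rewrite leqnn.
move=> n nN; apply/idP/idP => [xz|jn]; first by apply: jmin; rewrite xz orbT.
have jN := leq_ltn_trans jn nN; move: Pj; rewrite leqNgt jN/=; apply: le_trans.
by apply: (mw_nonincr hX); rewrite jn.
Qed.

(** By monotonicity F(z) lies between its values at the atoms on either side of [z]; beyond the
    extreme atoms, 0 <= F <= 1 suffices. *)
Lemma mw_kolmogorov_le : (1 < N)%N -> mw_solution N X ->
  (kolmogorov_dist (empirical x) (normal_prob 0 1) <= (1 / N%:R)%:E)%E.
Proof.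
move=> N1 hX; apply: ge_ereal_sup => _ [z _ <-].
have [j jN hj] := mw_threshold z hX.
rewrite /= (empirical_ray hj).
rewrite -[normal_prob 0 1 _]gcdfE -EFinB -[leLHS]/(`|_|)%:E lee_fin.
have N0 : 0 < N%:R :> R by rewrite ltr0n; lia.
have mono (u v : R) : u <= v -> gcdf u <= gcdf v.
  move=> uv; apply: (is_derive_ge0_nondecreasing is_derive_gcdf _ uv (lexx _)).
  by move=> t _; rewrite ltW ?gpdf_gt0.
have nat_sub i : (i <= N)%N -> (N - i)%:R / N%:R = 1 - i%:R / N%:R :> R.
  by move=> iN; rewrite natrB// mulrBl divff ?gt_eqF.
have i0 : 0 < N%:R^-1 :> R by rewrite invr_gt0.
have lo : (N - j)%:R / N%:R - 1 / N%:R <= gcdf z.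
  have [jlt|jge] := ltnP j N; last first.
    have -> : (N - j = 0)%N by lia.
    by have := gcdf_ge0 z; rewrite mul0r; lra.
  have /andP[q _] := mw_quantile hX jlt.
  have jz : X j <= z by rewrite hj.
  move: q (mono _ _ jz); rewrite !nat_sub// -[j.+1%:R]natr1 mulrDl; lra.
have hi : gcdf z <= (N - j)%:R / N%:R + 1 / N%:R.
  case: j jN hj {lo} => [|j] jN hj.
    by have := gcdf_le1 z; rewrite subn0 divff ?gt_eqF//; lra.
  have /andP[_ q] := mw_quantile hX jN.
  have zj : z <= X j by rewrite ltW// ltNge hj// ltnn.
  move: q (mono _ _ zj); rewrite !nat_sub// 1?ltnW// -[j.+1%:R]natr1 mulrDl; lra.
by rewrite ler_norml; apply/andP; split; lra.
Qed.

(* The empirical distribution function jumps by [1/N] at the largest atom. *)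
Lemma mw_kolmogorov_ge : (1 < N)%N -> mw_solution N X ->
  ((1 / (2 * N%:R))%:E <= kolmogorov_dist (empirical x) (normal_prob 0 1))%E.
Proof.
move=> N1 hX.
have N0 : 0 < N%:R :> R by rewrite ltr0n; lia.
have half : 1 / (2 * N%:R) = 2^-1 * N%:R^-1 :> R by rewrite div1r invfM.
have sup_ge (z : R) (j : nat) :
    (forall n, (n < N)%N -> (X n <= z) = (j <= n)%N) ->
    (`|(N - j)%:R / N%:R - gcdf z|%:E <=
     kolmogorov_dist (empirical x) (normal_prob 0 1))%E.
  move=> hj; apply: ereal_sup_ubound; exists z => //.
  by rewrite /= (empirical_ray hj) -[normal_prob 0 1 _]gcdfE.
(* If the upper tail is large, [z = X 0] works. If not, just left of [X 0] the empirical value is 1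
   - 1/N, while F still exceeds 1 - 1/(2N) by continuity. *)
have [small|big] := leP (1 / (2 * N%:R)) (1 - gcdf (X 0)).
  apply: le_trans (sup_ge (X 0) 0%N _); last first.
    by move=> n nN; rewrite (mw_nonincr hX).
  by rewrite lee_fin subn0 divff ?gt_eqF// (le_trans small)// ler_norm.
have x10 := mw_decr hX N1.
have cg : gcdf z @[z --> (X 0)^'-] --> gcdf (X 0).
  by apply: cvg_at_left_filter; exact: (is_derive_continuous is_derive_gcdf).
near (X 0)^'- => z.
have zx0 : z < X 0 by near: z; exact: nbhs_left_lt.
have x1z : X 1 < z by near: z; exact: nbhs_left_gt.
have gz : 1 - 1 / (2 * N%:R) < gcdf z.
  by near: z; apply: (cvgr_gt _ cg); rewrite ltrBlDl -ltrBlDr.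
apply: le_trans (sup_ge z 1%N _); last first.
  case=> [|n] nN; first by rewrite leNgt zx0.
  by rewrite (le_trans _ (ltW x1z))// (mw_nonincr hX).
rewrite lee_fin natrB ?(ltnW N1)// mulrBl divff ?gt_eqF// distrC.
apply: le_trans (ler_norm _).
by move: gz; rewrite half div1r; lra.
Unshelve. all: by end_near. Qed.

Lemma mw_wasserstein_dist_le : (1 < N)%N -> mw_solution N X ->
  (wasserstein_dist (empirical x) (normal_prob 0 1) <=
   (16 * Num.sqrt (ln N%:R) / N%:R)%:E)%E.
Proof.
move=> N1 hX; apply: ge_ereal_sup => _ [h /= lh <-].
have [v -> vle] := mw_wasserstein_le N1 hX lh.
rewrite integral_empirical; last exact: measurable_lip1.
under eq_bigr do rewrite -ord_extendE.
rewrite -EFinB -[leLHS]/(`|_|)%:E lee_fin.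
exact: le_trans vle (mw_range_le N1 hX).
Qed.

Lemma mw_wasserstein_dist_ge : (1 < N)%N -> mw_solution N X ->
  ((Num.sqrt (ln (N%:R / 2)) / (2 * N%:R) - 3 / 2 / N%:R)%:E <=
   wasserstein_dist (empirical x) (normal_prob 0 1))%E.
Proof.
move=> N1 hX; have N0 : 0 < N%:R :> R by rewrite ltr0n; lia.
have lh := mw_tents_lip1 N1 hX.
apply: (@le_trans _ _ (`|\int[empirical x]_t (mw_tents N X t)%:E -
    \int[normal_prob 0 1]_t (mw_tents N X t)%:E|)%E); last first.
  by apply: ereal_sup_ubound; exists (mw_tents N X).
rewrite integral_empirical; last exact: measurable_lip1.
(* The test function vanishes at the atoms, so only its normal integral remains. *)
rewrite big1; last by move=> i _; rewrite -ord_extendE (mw_tents_atom N1 hX).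
rewrite mul0r sub0e abseN gee0_abs; last first.
  apply: integral_ge0 => t _; rewrite lee_fin sumr_ge0// => i _.
  exact: tent_ge0.
apply: le_trans (mw_tents_integral_ge N1 hX); rewrite lee_fin.
have -> : Num.sqrt (ln (N%:R / 2)) / (2 * N%:R) - 3 / 2 / N%:R =
  (2 * Num.sqrt (ln (N%:R / 2)) - 6) / (4 * N%:R) :> R.
  by field; rewrite gt_eqF.
rewrite ler_pM2r ?invr_gt0 ?mulr_gt0// lerD2r.
exact: mw_range_ge.
Qed.

End empirical_theory.

Theorem theorem2p3 (R : realType) :
  exists C : R, 0 < C /\
    forall (N : nat) (x : 'I_N -> R),
      (2 <= N)%N ->
      strictly_decreasing x ->
      \sum_(n < N) x n = 0 ->
      satisfies_recursion x ->
      ((1 / (2 * N%:R))%:E <= kolmogorov_dist (empirical x) (normal_prob 0 1)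
        <= (55 / N%:R)%:E)%E /\
      ((Num.sqrt (ln (N%:R / 2)) / (2 * N%:R) - C / N%:R)%:E
        <= wasserstein_dist (empirical x) (normal_prob 0 1)
        <= (16 * Num.sqrt (ln N%:R) / N%:R)%:E)%E.
Proof.
(* The constant is 6/4, from the 6 in [mw_tents_integral_ge]. *)
exists (3 / 2); split=> [|N x N1 dx sx rx]; first by lra.
have hX := ord_extend_solution dx sx rx.
split; apply/andP; split.
- exact: mw_kolmogorov_ge.
- apply: (le_trans (mw_kolmogorov_le N1 hX)).
  by rewrite lee_fin ler_pM2r ?invr_gt0 ?ltr0n 1?ltnW//; lra.
- exact: mw_wasserstein_dist_ge.
- exact: mw_wasserstein_dist_le.
Qed.
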